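(* Let $T>0$, let $n,m\ge 1$ be integers, let $G,A_1,\dots,A_m:[0,T]\to M_n(\mathbb{C})$, let $d_1,\dots,d_m\in\mathbb{C}$, and let $U(t)=\mathcal{T}\exp\left(\int_0^t dt_1\,G(t_1)\right)$. Define $$x_k(t)=e^{(d_1+\dots+d_k)t}\,\mathcal{D}_U\!\left(e^{d_{k+1}t}A_{k+1},\dots,e^{d_mt}A_m\right)(t)\quad(0\le k\le m-1),\qquad x_m(t)=e^{(d_1+\dots+d_m)t}U(t),$$ where for $k=0$ the prefactor is $1$. Then these functions evolve according to the coupled differential equations $$\dot x_k(t)=\bigl(G(t)+(d_1+\dots+d_k)\mathbb{1}_n\bigr)x_k(t)+A_{k+1}(t)x_{k+1}(t)\quad(0\le k\le m-1),$$ $$\dot x_m(t)=\bigl(G(t)+(d_1+\dots+d_m)\mathbb{1}_n\bigr)x_m(t),$$ with initial conditions $x_0(0)=\dots=x_{m-1}(0)=0$ and $x_m(0)=\mathbb{1}_n$. Moreover, when $m=2$, for all $t\in[0,T]$, $$\mathcal{T}\exp\left[\int_0^t dt_1\begin{pmatrix}G(t_1)&A_1(t_1)&0\\0&G(t_1)+d_1\mathbb{1}_n&A_2(t_1)\\0&0&G(t_1)+(d_1+d_2)\mathbb{1}_n\end{pmatrix}\right]=\begin{pmatrix}U(t)&\mathcal{D}_U(e^{d_1t}A_1)(t)&\mathcal{D}_U(e^{d_1t}A_1,e^{d_2t}A_2)(t)\\0&e^{d_1t}U(t)&e^{d_1t}\mathcal{D}_U(e^{d_2t}A_2)(t)\\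0&0&e^{(d_1+d_2)t}U(t)\end{pmatrix}.$$
   Context: $M_n(\mathbb{C})$ is the set of $n\times n$ complex matrices and $\mathbb{1}_N$ is the $N\times N$ identity matrix. For $G:[0,T]\to M_N(\mathbb{C})$, the time-ordered exponential $\mathcal{T}\exp\left(\int_0^t dt_1\,G(t_1)\right)$ is notation for the value at $t$ of the unique solution $U$ of the initial value problem $\dot U(t)=G(t)U(t)$, $U(0)=\mathbb{1}_N$ on $[0,T]$. For matrix-valued functions $A_1,\dots,A_k:[0,T]\to M_n(\mathbb{C})$, $$\mathcal{D}_U(A_1,\dots,A_k)(t)=U(t)\int_0^t dt_1\int_0^{t_1}dt_2\cdots\int_0^{t_{k-1}}dt_k\;U^{-1}(t_1)A_1(t_1)U(t_1)\cdots U^{-1}(t_k)A_k(t_k)U(t_k).$$ An argument such as $e^{dt}A$ denotes the function $t\mapsto e^{dt}A(t)$, so it contributes $e^{dt_i}A(t_i)$ when it is the $i$-th argument. Standing assumption: all generators are regular enough that the relevant initial value problems have unique solutions and the integrals make sense (e.g. piecewise continuous on $[0,T]$; the differential equations are then understood at points of continuity). *)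

(* Defs.v *)
From HB Require Import structures.
From mathcomp Require Import all_boot all_order all_algebra.
From mathcomp Require Import complex.
From mathcomp Require Import all_classical all_reals all_analysis.
Set Implicit Arguments.
Unset Strict Implicit.
Unset Printing Implicit Defensive.
Import Order.TTheory GRing.Theory Num.Theory.
Import numFieldNormedType.Exports.
Local Open Scope classical_set_scope.
Local Open Scope ring_scope.
Local Open Scope complex_scope.

(* Typing R[i] as a numClosedFieldType gives it, and hence 'M[CC R]_(p, q),
   the topology that MathComp-Analysis puts on every numFieldType. *)
Definition CC (R : realType) : numClosedFieldType := R[i].

Section Defs.
Variable R : realType.

(* e^(a + ib) = e^a (cos b + i sin b) *)
Definition cexp (z : CC R) : CC R :=
  (expR (complex.Re z))%:C * (cos (complex.Im z) +i* sin (complex.Im z)).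

(* Functions on [0, T] are represented by total functions on R; the
   notions below only depend on the values on [0, T], and limits at the
   endpoints are one-sided. *)

Definition cont_at (T : R) p q (X : R -> 'M[CC R]_(p, q)) (t : R) : Prop :=
  X s @[s --> within `[0, T] (nbhs t)] --> X t.

Definition has_deriv (T : R) p q (X : R -> 'M[CC R]_(p, q)) (t : R)
    (L : 'M[CC R]_(p, q)) : Prop :=
  ((s - t)^-1)%:C *: (X s - X t) @[s --> within `[0, T] t^'] --> L.

Definition pw_continuous (T : R) p q (X : R -> 'M[CC R]_(p, q)) : Prop :=
  [/\ exists D : seq R,
        forall t, 0 <= t <= T -> t \notin D -> cont_at T X t,
      forall t, 0 <= t < T ->
        exists L : 'M[CC R]_(p, q), X s @[s --> t^'+] --> L
    & forall t, 0 < t <= T ->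
        exists L : 'M[CC R]_(p, q), X s @[s --> t^'-] --> L].

(* For a piecewise continuous G the differential equation is required at the
   points of continuity of G, and the solution is continuous on [0, T]. *)
Definition solves_ivp (T : R) n (G U : R -> 'M[CC R]_n) : Prop :=
  [/\ {within `[0, T], continuous U},
      U 0 = 1%:M
    & forall t, 0 <= t <= T -> cont_at T G t -> has_deriv T U t (G t *m U t)].

(* U(t) = T exp(\int_0^t G) on [0, T]: the time-ordered exponential is the
   unique solution of the initial value problem. *)
Definition is_Texp (T : R) n (G U : R -> 'M[CC R]_n) : Prop :=
  solves_ivp T G U /\
  forall V : R -> 'M[CC R]_n, solves_ivp T G V ->
    forall t, 0 <= t <= T -> V t = U t.

Definition mint p q (F : R -> 'M[CC R]_(p, q)) (t : R) : 'M[CC R]_(p, q) :=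
  \matrix_(i, j)
    ((\int[lebesgue_measure]_(s in `[0, t]) complex.Re (F s i j))%R +i*
     (\int[lebesgue_measure]_(s in `[0, t]) complex.Im (F s i j))%R).

(* nested_int U P [:: A1; ...; Ak] t =
     \int_0^t dt1 \int_0^t1 dt2 ... \int_0^t(k-1) dtk
       P U^-1(t1) A1(t1) U(t1) ... U^-1(tk) Ak(tk) U(tk);
   P accumulates the factors in the variables that are already bound. *)
Fixpoint nested_int n (U : R -> 'M[CC R]_n) (P : 'M[CC R]_n)
    (As : seq (R -> 'M[CC R]_n)) (t : R) : 'M[CC R]_n :=
  if As is A :: As' then
    mint (fun s => nested_int U (P *m (invmx (U s) *m A s *m U s)) As' s) t
  else P.

Definition DU n (U : R -> 'M[CC R]_n) (As : seq (R -> 'M[CC R]_n)) (t : R) :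
    'M[CC R]_n :=
  U t *m nested_int U 1%:M As t.

Definition exp_scale n (c : CC R) (A : R -> 'M[CC R]_n) : R -> 'M[CC R]_n :=
  fun t => cexp (c * t%:C) *: A t.

(* d 1, ..., d m and A 1, ..., A m are indexed from 1. *)
Definition dsum (d : nat -> CC R) (k : nat) : CC R :=
  \sum_(1 <= i < k.+1) d i.

Definition xfun n (U : R -> 'M[CC R]_n) (A : nat -> R -> 'M[CC R]_n)
    (d : nat -> CC R) (m k : nat) (t : R) : 'M[CC R]_n :=
  cexp (dsum d k * t%:C) *:
    (if (k < m)%N
     then DU U [seq exp_scale (d i) (A i) | i <- index_iota k.+1 m.+1] t
     else U t).

Definition block3_mx n (M11 M12 M13 M21 M22 M23 M31 M32 M33 : 'M[CC R]_n) :
    'M[CC R]_(n + (n + n)) :=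
  block_mx M11 (row_mx M12 M13)
           (col_mx M21 M31) (block_mx M22 M23 M32 M33).

End Defs.

(* Main.v *)
Require Import Defs.
From HB Require Import structures.
From mathcomp Require Import all_boot all_order all_algebra.
From mathcomp Require Import complex ring lra zify.
From mathcomp Require Import all_classical all_reals all_analysis.
Set Implicit Arguments.
Unset Strict Implicit.
Unset Printing Implicit Defensive.
Import Order.TTheory GRing.Theory Num.Theory.
Import numFieldNormedType.Exports.
Local Open Scope classical_set_scope.
Local Open Scope ring_scope.
Local Open Scope complex_scope.

(* Pulling the factors U^-1 A U out of the iterated integral shows that
   D_U(A_1, ..., A_k) = U I with I' = U^-1 A_1 U I_2, where U I_2 = D_U(A_2, ..., A_k);
   hence D_U(A_1, ..., A_k)' = G D_U(A_1, ..., A_k) + A_1 D_U(A_2, ..., A_k), and the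
   factors e^(dt) only add a multiple of the identity to G.  The rest rests on one
   fact: a continuous W with W' = H W off a finite set, H bounded, that vanishes at
   some t0 in [0, T] vanishes on [0, T] (Gronwall in both time directions).  It
   gives the invertibility of U (t0 = t), the uniqueness of the block solution
   (t0 = 0), and, with H = 0, the extraction of constant matrices from integrals. *)

(** * Entrywise limits *)

(** The first obstacle is that [nested_int] threads the outer factors through an accumulator, so
    that the integrand of each level depends on all the variables bound before it, and the
    fundamental theorem of calculus does not apply to it as it stands. Matrices do not commute, but
    the accumulator stands leftmost and can therefore leave the integral on that side. The second
    obstacle is that derivatives are complex and guaranteed only off a finite set, whereas deducing
    monotonicity from the sign of a derivative is a real statement on an interval. Linear systems
    are therefore split into real and imaginary parts, and Gronwall's inequality is applied to the
    sum of squares, a differentiable substitute for a norm, on the intervals between exceptional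
    points. The backward direction matters because a kernel vector of [U t] has to be carried back
    to time 0, where [U] is the identity. For the block exponential, existence comes from the
    explicit matrix, so that the equation and uniqueness are what is left to check. *)

Lemma cvg_mxP (K : numFieldType) (S : Type) (F : set_system S) {FF : Filter F}
    p q (X : S -> 'M[K]_(p, q)) (L : 'M[K]_(p, q)) :
  X @ F --> L <-> forall i j, X s i j @[s --> F] --> L i j.
Proof.
split=> [XL i j|XL].
  exact: (@cvg_comp _ _ _ X (fun M : 'M[K]_(p, q) => M i j) _ _ _ XL
            (@coord_continuous _ _ _ i j L)).
apply/cvg_ballP => e e0.
have : \forall s \near F, forall ij : 'I_p * 'I_q,
    ball (L ij.1 ij.2) e (X s ij.1 ij.2).
  by apply: filter_forall => -[i j]; exact: cvg_ball (XL i j) _ e0.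
by apply: filterS => s h; split=> // i j; exact: (h (i, j)).
Qed.

Lemma cvg_row_mx (K : numFieldType) (S : Type) (F : set_system S) {FF : Filter F}
    p q1 q2 (X : S -> 'M[K]_(p, q1)) (Y : S -> 'M[K]_(p, q2))
    (L : 'M[K]_(p, q1)) (M : 'M[K]_(p, q2)) :
  X s @[s --> F] --> L -> Y s @[s --> F] --> M ->
  row_mx (X s) (Y s) @[s --> F] --> row_mx L M.
Proof.
move=> /cvg_mxP XL /cvg_mxP YM; apply/cvg_mxP => i j.
rewrite mxE; under eq_cvg do rewrite mxE.
by case: (fintype.split j) => k; [exact: XL|exact: YM].
Qed.

Lemma cvg_col_mx (K : numFieldType) (S : Type) (F : set_system S) {FF : Filter F}
    p1 p2 q (X : S -> 'M[K]_(p1, q)) (Y : S -> 'M[K]_(p2, q))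
    (L : 'M[K]_(p1, q)) (M : 'M[K]_(p2, q)) :
  X s @[s --> F] --> L -> Y s @[s --> F] --> M ->
  col_mx (X s) (Y s) @[s --> F] --> col_mx L M.
Proof.
move=> /cvg_mxP XL /cvg_mxP YM; apply/cvg_mxP => i j.
rewrite mxE; under eq_cvg do rewrite mxE.
by case: (fintype.split i) => k; [exact: XL|exact: YM].
Qed.

Lemma cvg_mxsub (K : numFieldType) (S : Type) (F : set_system S) {FF : Filter F}
    p q p' q' (f : 'I_p' -> 'I_p) (g : 'I_q' -> 'I_q) (X : S -> 'M[K]_(p, q))
    (L : 'M[K]_(p, q)) :
  X @ F --> L -> mxsub f g (X s) @[s --> F] --> mxsub f g L.
Proof.
move=> /cvg_mxP XL; apply/cvg_mxP => i j.
by rewrite mxE; under eq_cvg do rewrite mxE; exact: XL.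
Qed.

Lemma cvg_sum_seq (K : numFieldType) (S : Type) (F : set_system S)
    {FF : Filter F} (I : Type) (r : seq I) (P : pred I) (f : I -> S -> K)
    (l : I -> K) :
  (forall i, f i @ F --> l i) ->
  \sum_(i <- r | P i) f i s @[s --> F] --> \sum_(i <- r | P i) l i.
Proof. by move=> fl; apply: cvg_big => //; exact: add_continuous. Qed.

Lemma cvg_prod_seq (K : numFieldType) (S : Type) (F : set_system S)
    {FF : Filter F} (I : Type) (r : seq I) (P : pred I) (f : I -> S -> K)
    (l : I -> K) :
  (forall i, f i @ F --> l i) ->
  \prod_(i <- r | P i) f i s @[s --> F] --> \prod_(i <- r | P i) l i.
Proof. by move=> fl; apply: cvg_big => //; exact: mul_continuous. Qed.

Lemma cvg_mulmx (K : numFieldType) (S : Type) (F : set_system S) {FF : Filter F}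
    p q r (X : S -> 'M[K]_(p, q)) (Y : S -> 'M[K]_(q, r))
    (L : 'M[K]_(p, q)) (M : 'M[K]_(q, r)) :
  X @ F --> L -> Y @ F --> M -> X s *m Y s @[s --> F] --> L *m M.
Proof.
move=> /cvg_mxP XL /cvg_mxP YM; apply/cvg_mxP => i j.
rewrite mxE; under eq_cvg do rewrite mxE.
by apply: cvg_sum_seq => k; exact: cvgM.
Qed.

Lemma cvg_subr_mx (K : numFieldType) (S : Type) (F : set_system S) {FF : Filter F}
    p q (X : S -> 'M[K]_(p, q)) (Y : S -> 'M[K]_(p, q)) (L M : 'M[K]_(p, q)) :
  X s @[s --> F] --> L -> Y s @[s --> F] --> M -> X s - Y s @[s --> F] --> L - M.
Proof. exact: cvgB. Qed.

Lemma cvg_det (K : numFieldType) (S : Type) (F : set_system S) {FF : Filter F}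
    p (X : S -> 'M[K]_p)
    (L : 'M[K]_p) : X @ F --> L -> \det (X s) @[s --> F] --> \det L.
Proof.
move=> /cvg_mxP XL; apply: cvg_sum_seq => s.
by apply: cvgM; [exact: cvg_cst|apply: cvg_prod_seq => i; exact: XL].
Qed.

(** Cramer's rule: on invertible matrices the inverse is the adjugate divided by the determinant,
    and both are polynomials in the entries. *)
Lemma cvg_invmx (K : numFieldType) (S : Type) (F : set_system S) {FF : Filter F}
    p (X : S -> 'M[K]_p)
    (L : 'M[K]_p) :
  L \in unitmx -> (\forall s \near F, X s \in unitmx) ->
  X @ F --> L -> invmx (X s) @[s --> F] --> invmx L.
Proof.
move=> uL uX XL; rewrite {2}/invmx uL.
have /near_eq_cvg/cvg_trans : {near F, (fun s => (\det (X s))^-1 *: \adj (X s))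
    =1 (fun s => invmx (X s))}.
  by near=> s; rewrite /invmx ifT//; near: s.
apply; apply: cvgZ.
  apply: cvgV; last exact: cvg_det.
  by rewrite -unitfE -unitmxE.
apply/cvg_mxP => i j.
(* The minor is rewritten as an [mxsub], whose limit is entrywise. *)
have adjE (A : 'M[K]_p) :
    \adj A i j = (-1) ^+ (j + i) * \det (mxsub (lift j) (lift i) A).
  by rewrite mxE; congr (_ * \det _); apply/matrixP => k l; rewrite !mxE.
rewrite adjE; under eq_cvg do rewrite adjE.
by apply: cvgM; [exact: cvg_cst|apply: cvg_det; exact: cvg_mxsub].
Unshelve. all: by end_near. Qed.

(** * Difference quotients of matrix functions, with [k s] in the role of 1/(s - t) *)

Section difference_quotients.
Variables (K : numFieldType) (S : Type) (F : set_system S).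
Hypothesis FF : Filter F.
Variable k : S -> K.

Lemma cvg_quotient_cst p q (X : 'M[K]_(p, q)) :
  k s *: (X - X) @[s --> F] --> (0 : 'M[K]_(p, q)).
Proof. by under eq_cvg do rewrite subrr scaler0; exact: cvg_cst. Qed.

Lemma cvg_quotientB p q (X Y : S -> 'M[K]_(p, q)) (X0 Y0 L M : 'M[K]_(p, q)) :
  k s *: (X s - X0) @[s --> F] --> L -> k s *: (Y s - Y0) @[s --> F] --> M ->
  k s *: ((X s - Y s) - (X0 - Y0)) @[s --> F] --> L - M.
Proof.
move=> XL YM; under eq_cvg do rewrite opprD addrACA -opprD scalerBr.
exact: cvgB.
Qed.

(** Leibniz rule without commutativity: the increment of the product splits as (X s - X0) Y s + X0
    (Y s - Y0), so a limit is asked of [Y] only. *)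
Lemma cvg_quotientM p q r (X : S -> 'M[K]_(p, q)) (Y : S -> 'M[K]_(q, r))
    (X0 L : 'M[K]_(p, q)) (Y0 M : 'M[K]_(q, r)) :
  k s *: (X s - X0) @[s --> F] --> L -> k s *: (Y s - Y0) @[s --> F] --> M ->
  Y s @[s --> F] --> Y0 ->
  k s *: (X s *m Y s - X0 *m Y0) @[s --> F] --> L *m Y0 + X0 *m M.
Proof.
move=> XL YM YY0.
have E s : k s *: (X s *m Y s - X0 *m Y0) =
    (k s *: (X s - X0)) *m Y s + X0 *m (k s *: (Y s - Y0)).
  by rewrite -scalemxAl -scalemxAr -scalerDr mulmxBl mulmxBr addrA subrK.
under eq_cvg do rewrite E.
by apply: cvgD; apply: cvg_mulmx => //; exact: cvg_cst.
Qed.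

Lemma cvg_quotient_row_mx p q1 q2 (X : S -> 'M[K]_(p, q1)) (Y : S -> 'M[K]_(p, q2))
    (X0 L : 'M[K]_(p, q1)) (Y0 M : 'M[K]_(p, q2)) :
  k s *: (X s - X0) @[s --> F] --> L -> k s *: (Y s - Y0) @[s --> F] --> M ->
  k s *: (row_mx (X s) (Y s) - row_mx X0 Y0) @[s --> F] --> row_mx L M.
Proof.
move=> XL YM; under eq_cvg do rewrite opp_row_mx add_row_mx scale_row_mx.
exact: cvg_row_mx.
Qed.

Lemma cvg_quotient_col_mx p1 p2 q (X : S -> 'M[K]_(p1, q)) (Y : S -> 'M[K]_(p2, q))
    (X0 L : 'M[K]_(p1, q)) (Y0 M : 'M[K]_(p2, q)) :
  k s *: (X s - X0) @[s --> F] --> L -> k s *: (Y s - Y0) @[s --> F] --> M ->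
  k s *: (col_mx (X s) (Y s) - col_mx X0 Y0) @[s --> F] --> col_mx L M.
Proof.
move=> XL YM; under eq_cvg do rewrite opp_col_mx add_col_mx scale_col_mx.
exact: cvg_col_mx.
Qed.

(** Differentiability implies continuity: with [h] standing for s - t, [X s] is [X0] plus [h s]
    times the difference quotient. *)
Lemma quotient_cvg p q (X : S -> 'M[K]_(p, q)) (X0 L : 'M[K]_(p, q)) (h : S -> K) :
  (\forall s \near F, h s * k s = 1) -> h @ F --> 0 ->
  k s *: (X s - X0) @[s --> F] --> L -> X @ F --> X0.
Proof.
move=> hk h0 XL.
have : X0 + h s *: (k s *: (X s - X0)) @[s --> F] --> X0 + 0 *: L.
  by apply: cvgD; [exact: cvg_cst|exact: cvgZ].
rewrite scale0r addr0; apply: cvg_trans; apply: near_eq_cvg.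
near=> s; rewrite scalerA (_ : h s * k s = 1) ?scale1r 1?addrC ?subrK//.
by near: s.
Unshelve. all: by end_near. Qed.

End difference_quotients.

(** * Complex limits through real and imaginary parts *)

Section complex_cvg.
Variable R : realType.
Implicit Types (z : CC R) (x e : R).

Lemma Re_mul_real x z : complex.Re (x%:C * z) = x * complex.Re z.
Proof. by case: z => a b /=; rewrite mul0r subr0. Qed.

Lemma Im_mul_real x z : complex.Im (x%:C * z) = x * complex.Im z.
Proof. by case: z => a b /=; rewrite mul0r addr0. Qed.

Lemma normCC_Re z : `|complex.Re z|%:C <= `|z|.
Proof. exact: normc_ge_Re. Qed.

Lemma normCC_Im z : `|complex.Im z|%:C <= `|z|.
Proof.
rewrite normc_def lecR.
apply: (@le_trans _ _ (Num.sqrt (complex.Im z ^+ 2))); first by rewrite sqrtr_sqr.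
by rewrite ler_wsqrtr// lerDr sqr_ge0.
Qed.

Lemma normCC_le z : `|z| <= (`|complex.Re z| + `|complex.Im z|)%:C.
Proof.
rewrite normc_def lecR.
apply: (@le_trans _ _ (Num.sqrt ((`|complex.Re z| + `|complex.Im z|) ^+ 2)));
  last by rewrite sqrtr_sqr ger0_norm ?addr_ge0.
rewrite ler_wsqrtr//.
rewrite sqrrD !real_normK ?num_real// -addrA lerD2l lerDr.
by rewrite mulrn_wge0// mulr_ge0.
Qed.

Lemma cvg_CCP (S : Type) (F : set_system S) {FF : Filter F} (f : S -> CC R) z :
  f @ F --> z <->
  complex.Re (f s) @[s --> F] --> complex.Re z /\
  complex.Im (f s) @[s --> F] --> complex.Im z.
Proof.
split=> [fz|[/cvgrPdist_lt re /cvgrPdist_lt im]].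
  have close e : 0 < e -> \forall s \near F, `|z - f s| < e%:C.
    by move=> e0; move/cvgrPdist_lt : fz; apply; rewrite ltcR.
  split; apply/cvgrPdist_lt => e /close; apply: filterS => s.
    by move/(le_lt_trans (normCC_Re _)); rewrite raddfB ltcR.
  by move/(le_lt_trans (normCC_Im _)); rewrite raddfB ltcR.
apply/cvgrPdist_lt => e e0.
(* A positive element of [CC R] is real, so the tolerance may be replaced by its real part and
   halved there. *)
have eE : e = (complex.Re e)%:C by rewrite RRe_real// gtr0_real.
have : 0 < complex.Re e by rewrite -ltcR -eE.
move: (complex.Re e) eE => r -> r0; have r2 : 0 < r / 2 by rewrite divr_gt0.
near=> s; apply: le_lt_trans (normCC_le _) _.
rewrite ltcR (splitr r) !raddfB ltrD//; near: s; [exact: re|exact: im].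
Unshelve. all: by end_near. Qed.

End complex_cvg.

(** * Real differential inequalities *)

(** Carathéodory's criterion: the difference quotient, completed by [l] at t, is continuous at t.
    This links [is_derive] to the punctured limits behind [has_deriv]. *)
Lemma is_derive_quotient (R : realType) (f : R -> R) (t l : R) :
  is_derive t 1 f l <-> (s - t)^-1 * (f s - f t) @[s --> t^'] --> l.
Proof.
split=> [/is_derive1_caratheodory[g [fg gt gl]]|ql].
  have /near_eq_cvg/cvg_trans : {near t^', g =1 fun s => (s - t)^-1 * (f s - f t)}.
    near=> s; rewrite fg mulrC mulfK// subr_eq0.
    by near: s; exact: nbhs_dnbhs_neq.
  by apply; rewrite -gl; exact/continuous_withinNx.
apply/is_derive1_caratheodory.
exists (fun s => if s == t then l else (s - t)^-1 * (f s - f t)).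
rewrite eqxx; split => //.
  move=> s; have [->|st] := eqVneq s t; first by rewrite !subrr mulr0.
  by rewrite mulrC mulrA divff ?mul1r// subr_eq0.
apply/continuous_withinNx; rewrite eqxx.
apply: cvg_trans ql; apply: near_eq_cvg.
near=> s; rewrite ifN//.
by near: s; exact: nbhs_dnbhs_neq.
Unshelve. all: by end_near. Qed.

(** Induction on [D]: an exceptional point inside the interval cuts it in two, and continuity on the
    closed pieces lets the two inequalities be chained at the cut; a point not inside is dropped. *)
Lemma le_derive_except (R : realType) (D : seq R) (f : R -> R) (a b : R) :
  a <= b -> {within `[a, b], continuous f} ->
  (forall x, a < x < b -> x \notin D -> exists2 l, is_derive x 1 f l & 0 <= l) ->
  f a <= f b.
Proof.
elim: D a b => [|c D IH] a b ab cf df.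
  have dv x : x \in `]a, b[ -> derivable f x 1 /\ 0 <= f^`()%classic x.
    rewrite in_itv/= => /df -/(_ isT)[l fl l0]; split; first exact: ex_derive.
    by rewrite derive1E derive_val.
  by apply: (ger0_derive1_le_cc (fun x h => (dv x h).1) (fun x h => (dv x h).2) cf);
    rewrite ?in_itv/= ?lexx ?ab.
have [/andP[ac cb]|cab] := boolP (a < c < b).
  apply: (@le_trans _ _ (f c)); apply: IH; rewrite ?ltW//.
  - by apply: continuous_subspaceW cf; apply: subset_itvl; rewrite bnd_simp ltW.
  - move=> x /andP[ax xc] xD; apply: df; first by rewrite ax (lt_trans xc).
    by rewrite inE negb_or lt_eqF.
  - by apply: continuous_subspaceW cf; apply: subset_itvr; rewrite bnd_simp ltW.
  - move=> x /andP[cx xb] xD; apply: df; first by rewrite xb (lt_trans ac).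
    by rewrite inE negb_or gt_eqF.
apply: IH => // x xab xD; apply: df => //.
by rewrite inE negb_or xD andbT; apply: contraNneq cab => <-.
Qed.

(* The hypothesis makes g(x) e^(-Cx) nonincreasing and g(x) e^(Cx) nondecreasing. *)
Lemma gronwall_both_directions (R : realType) (D : seq R) (g : R -> R) (a b C : R) :
  a <= b -> {within `[a, b], continuous g} ->
  (forall x, a < x < b -> x \notin D ->
     exists2 l, is_derive x 1 g l & `|l| <= C * g x) ->
  g b * expR (- C * b) <= g a * expR (- C * a) /\
  g a * expR (C * a) <= g b * expR (C * b).
Proof.
move=> ab cg dg.
have ec c : {within `[a, b], continuous (fun x => expR (c * x))}.
  apply: continuous_subspaceT => x.
  by apply: continuous_comp; [exact: mulrl_continuous|exact: continuous_expR].
have ed (c x : R) : is_derive x 1 (fun x : R => expR (c * x)) (expR (c * x) * c).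
  apply: is_derive_eq.
  by rewrite /GRing.scale/= mulr1 mulrC.
split; last first.
  apply: (@le_derive_except _ D (fun x => g x * expR (C * x))) => //.
    by move=> x; apply: cvgM; [exact: cg|exact: ec].
  move=> x xab xD; have [l gl lC] := dg x xab xD.
  exists (g x * (expR (C * x) * C) + expR (C * x) * l).
    by apply: is_deriveM.
  rewrite mulrCA -mulrDr mulr_ge0 ?expR_ge0// mulrC.
  by move: lC; rewrite ler_norml => /andP[+ _]; rewrite -subr_ge0 opprK addrC.
rewrite -lerN2.
apply: (@le_derive_except _ D (fun x => - (g x * expR (- C * x)))) => //.
  by move=> x; apply: cvgN; apply: cvgM; [exact: cg|exact: ec].
move=> x xab xD; have [l gl lC] := dg x xab xD.
exists (- (g x * (expR (- C * x) * - C) + expR (- C * x) * l)).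
  by apply: is_deriveN; apply: is_deriveM.
rewrite mulrCA -mulrDr -mulrN mulr_ge0 ?expR_ge0// mulrN opprD opprK mulrC.
by move: lC; rewrite ler_norml => /andP[_]; rewrite subr_ge0.
Qed.

Lemma is_derive_sum_seq (R : realType) (I : Type) (r : seq I)
    (f : I -> R -> R) (l : I -> R) (t : R) :
  (forall i, is_derive t 1 (f i) (l i)) ->
  is_derive t 1 (fun s => \sum_(i <- r) f i s) (\sum_(i <- r) l i).
Proof.
move=> fl; elim: r => [|i r IH].
  under eq_fun do rewrite big_nil.
  by rewrite big_nil; exact: is_derive_cst.
under eq_fun do rewrite big_cons.
by rewrite big_cons; apply: is_deriveD.
Qed.

(* Gronwall's inequality for the sum of squares, forwards and backwards from t0 *)
Lemma linear_system_zero (R : realType) (I : finType) (D : seq R)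
    (w : I -> R -> R) (T K t0 : R) :
  0 <= K -> 0 <= t0 <= T ->
  (forall i, {within `[0, T], continuous (w i)}) ->
  (forall t, 0 < t < T -> t \notin D -> forall i,
     exists2 l, is_derive t 1 (w i) l & `|l| <= K * \sum_j `|w j t|) ->
  (forall i, w i t0 = 0) ->
  forall t, 0 <= t <= T -> forall i, w i t = 0.
Proof.
move=> K0 /andP[t00 t0T] cw dw w0.
pose g t := \sum_i w i t ^+ 2.
(* The derivative of [g] is the sum over i of 2 w_i w_i'. Each |w_i w_i'| is at most K times the sum
   over j of |w_i w_j|, hence at most K #|I| g, and there are #|I| such terms. *)
pose C := 2 * K * (#|I|%:R * #|I|%:R).
have g0 t : 0 <= g t by apply: sumr_ge0 => i _; rewrite sqr_ge0.
have wg i t : w i t ^+ 2 <= g t.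
  by rewrite /g (bigD1 i)//= lerDl sumr_ge0// => j _; rewrite sqr_ge0.
have wwg i j t : `|w i t| * `|w j t| <= g t.
  have : `|w i t| * `|w j t| <= Num.max `|w i t| `|w j t| ^+ 2.
    by rewrite expr2 ler_pM// le_max lexx ?orbT.
  move/le_trans; apply.
  by case: (lerP `|w i t| `|w j t|) => _; rewrite real_normK ?num_real.
have cg : {within `[0, T], continuous g}.
  move=> x; apply: cvg_big; first exact: add_continuous.
  by move=> i _; under eq_cvg do rewrite expr2; rewrite expr2; apply: cvgM; exact: cw.
have dg t : 0 < t < T -> t \notin D ->
    exists2 l, is_derive t 1 g l & `|l| <= C * g t.
  move=> tT tD.
  have /choice[l lP] : forall i, exists l, is_derive t 1 (w i) l /\
      `|l| <= K * \sum_j `|w j t|.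
    by move=> i; have [l] := dw t tT tD i; exists l.
  exists (\sum_i 2 * (w i t * l i)).
    apply: is_derive_sum_seq => i.
    have [wl _] := lP i.
    apply: is_derive_eq.
    by rewrite /GRing.scale/=; ring.
  apply: (le_trans (ler_norm_sum _ _ _)).
  apply: (@le_trans _ _ (\sum_(i : I) 2 * K * (#|I|%:R * g t))).
    apply: ler_sum => i _; have [_ li] := lP i.
    rewrite !normrM (ger0_norm (ler0n _ 2)) -!mulrA ler_pM2l//.
    apply: (@le_trans _ _ (`|w i t| * (K * \sum_j `|w j t|))).
      exact: ler_wpM2l.
    rewrite mulrCA ler_wpM2l// mulr_sumr.
    apply: (@le_trans _ _ (\sum_(j : I) g t)); first by apply: ler_sum.
    by rewrite sumr_const mulr_natl.
  by rewrite sumr_const /C -mulr_natl; lra.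
have gt0 : g t0 = 0 by apply: big1 => i _; rewrite w0 expr0n.
suff gz t : 0 <= t <= T -> g t <= 0.
  move=> t /gz gt i; apply/eqP; rewrite -sqrf_eq0 eq_le sqr_ge0 andbT.
  exact: le_trans (wg i t) gt.
(* Before [t0] the growth of g(x) e^(Cx) is used, after [t0] the decay of g(x) e^(-Cx); either way
   g(t) times a positive factor is at most a multiple of g(t0) = 0. *)
move=> /andP[t_ge0 tT]; have [tt0|t0t] := leP t t0.
  have [||_] := @gronwall_both_directions _ D g t t0 C tt0.
  - apply: continuous_subspaceW cg; apply: subset_itv; rewrite bnd_simp//.
  - move=> x /andP[tx xt0]; apply: dg.
    by rewrite (le_lt_trans t_ge0 tx) (lt_le_trans xt0 t0T).
  by rewrite gt0 mul0r pmulr_lle0// expR_gt0.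
have [||+ _] := @gronwall_both_directions _ D g t0 t C (ltW t0t).
- apply: continuous_subspaceW cg; apply: subset_itv; rewrite bnd_simp//.
- move=> x /andP[tx xt0]; apply: dg.
  by rewrite (le_lt_trans t00 tx) (lt_le_trans xt0 tT).
by rewrite gt0 mul0r pmulr_lle0// expR_gt0.
Qed.

(** * Matrix-valued functions and linear differential equations *)

Section matrix_calculus.
Variables (R : realType) (T : R).

Lemma cont_onP p q (X : R -> 'M[CC R]_(p, q)) :
  {within `[0, T], continuous X} <-> forall t, 0 <= t <= T -> cont_at T X t.
Proof.
split=> [/subspace_continuousP cX t tT|cX].
  by apply: cX; rewrite /= in_itv.
by apply/subspace_continuousP => t /=; rewrite in_itv/= => /cX.
Qed.

Lemma eq_cont_at p q (X Y : R -> 'M[CC R]_(p, q)) t :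
  0 <= t <= T -> (forall s, 0 <= s <= T -> X s = Y s) ->
  cont_at T X t -> cont_at T Y t.
Proof.
move=> tT XY; rewrite /cont_at -XY//; apply: cvg_trans.
apply: near_eq_cvg; near=> s; rewrite XY//.
have : `[0, T]%classic s by near: s; exact: withinT.
by rewrite /= in_itv.
Unshelve. all: by end_near. Qed.

Lemma cont_atM p q r (X : R -> 'M[CC R]_(p, q)) (Y : R -> 'M[CC R]_(q, r)) t :
  cont_at T X t -> cont_at T Y t -> cont_at T (fun s => X s *m Y s) t.
Proof. exact: cvg_mulmx. Qed.

Lemma has_derivP p q (X : R -> 'M[CC R]_(p, q)) t L :
  has_deriv T X t L <-> forall i j,
    (s - t)^-1 * (complex.Re (X s i j) - complex.Re (X t i j))
       @[s --> within `[0, T] t^'] --> complex.Re (L i j) /\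
    (s - t)^-1 * (complex.Im (X s i j) - complex.Im (X t i j))
       @[s --> within `[0, T] t^'] --> complex.Im (L i j).
Proof.
split=> [/cvg_mxP h i j|h].
  have /cvg_CCP[] := h i j.
  under eq_cvg do rewrite !mxE Re_mul_real raddfB/=.
  by under [in X in _ -> X -> _]eq_cvg do rewrite !mxE Im_mul_real raddfB/=.
apply/cvg_mxP => i j; apply/cvg_CCP; have [hr hi] := h i j; split.
  by under eq_cvg do rewrite !mxE Re_mul_real raddfB/=.
by under eq_cvg do rewrite !mxE Im_mul_real raddfB/=.
Qed.

Lemma cvg_realC (S : Type) (F : set_system S) {FF : Filter F} (f : S -> R) (l : R) :
  f @ F --> l -> ((f s)%:C : CC R) @[s --> F] --> (l%:C : CC R).
Proof. by move=> fl; apply/cvg_CCP; split=> //=; exact: cvg_cst. Qed.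

Lemma near_within_dnbhs t : \forall s \near within `[0, T] t^', 0 <= s <= T /\ s != t.
Proof.
near=> s; split.
  have : `[0, T]%classic s by near: s; exact: withinT.
  by rewrite /= in_itv.
near: s.
exact: (@cvg_within _ t^' _ `[0, T]%classic (fun s => s != t)
  (nbhs_dnbhs_neq t)).
Unshelve. all: by end_near. Qed.

Lemma has_deriv_cvg p q (X : R -> 'M[CC R]_(p, q)) t L :
  has_deriv T X t L -> X s @[s --> within `[0, T] t^'] --> X t.
Proof.
apply: (@quotient_cvg _ _ _ _ _ _ _ _ _ _ (fun s => (s - t)%:C)).
  near=> s; have [_ st] : 0 <= s <= T /\ s != t.
    by near: s; exact: near_within_dnbhs.
  by rewrite -rmorphM/= divff ?subr_eq0.
apply: (@cvg_realC _ _ _ _ 0); apply: cvg_within_filter.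
have : s - t @[s --> t^'] --> t - t.
  by apply: cvgB; [exact: cvg_within|exact: cvg_cst].
by rewrite subrr.
Unshelve. all: by end_near. Qed.

Lemma eq_has_deriv p q (X Y : R -> 'M[CC R]_(p, q)) t L :
  0 <= t <= T -> (forall s, 0 <= s <= T -> X s = Y s) ->
  has_deriv T X t L -> has_deriv T Y t L.
Proof.
move=> tT XY; rewrite /has_deriv -XY//; apply: cvg_trans.
apply: near_eq_cvg; near=> s; rewrite XY//.
by have [] : 0 <= s <= T /\ s != t by near: s; exact: near_within_dnbhs.
Unshelve. all: by end_near. Qed.

Lemma has_deriv_cst p q (M : 'M[CC R]_(p, q)) t : has_deriv T (fun=> M) t 0.
Proof. exact: cvg_quotient_cst. Qed.

(* Below, [CC R] is passed explicitly: left to unification, matching its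
   structures against those of [R[i]] does not terminate in practice. *)
Lemma has_derivB p q (X Y : R -> 'M[CC R]_(p, q)) t L M :
  has_deriv T X t L -> has_deriv T Y t M ->
  has_deriv T (fun s => X s - Y s) t (L - M).
Proof.
rewrite /has_deriv => XL YM.
have := @cvg_quotientB (CC R) R (within `[0, T] t^') _
  (fun s => ((s - t)^-1)%:C) _ _ _ _ _ _ _ _ XL YM.
apply.
Qed.

Lemma has_derivM p q r (X : R -> 'M[CC R]_(p, q)) (Y : R -> 'M[CC R]_(q, r)) t L M :
  has_deriv T X t L -> has_deriv T Y t M ->
  has_deriv T (fun s => X s *m Y s) t (L *m Y t + X t *m M).
Proof.
move=> XL YM; have YY := has_deriv_cvg YM; move: XL YM; rewrite /has_deriv => XL YM.
have := @cvg_quotientM (CC R) R (within `[0, T] t^') _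
  (fun s => ((s - t)^-1)%:C) _ _ _ _ _ _ _ _ _ XL YM YY.
apply.
Qed.

Lemma has_deriv_row_mx p q1 q2 (X : R -> 'M[CC R]_(p, q1))
    (Y : R -> 'M[CC R]_(p, q2)) t L M :
  has_deriv T X t L -> has_deriv T Y t M ->
  has_deriv T (fun s => row_mx (X s) (Y s)) t (row_mx L M).
Proof.
rewrite /has_deriv => XL YM.
have := @cvg_quotient_row_mx (CC R) R (within `[0, T] t^') _
  (fun s => ((s - t)^-1)%:C) _ _ _ _ _ _ _ _ _ XL YM.
apply.
Qed.

Lemma has_deriv_col_mx p1 p2 q (X : R -> 'M[CC R]_(p1, q))
    (Y : R -> 'M[CC R]_(p2, q)) t L M :
  has_deriv T X t L -> has_deriv T Y t M ->
  has_deriv T (fun s => col_mx (X s) (Y s)) t (col_mx L M).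
Proof.
rewrite /has_deriv => XL YM.
have := @cvg_quotient_col_mx (CC R) R (within `[0, T] t^') _
  (fun s => ((s - t)^-1)%:C) _ _ _ _ _ _ _ _ _ XL YM.
apply.
Qed.

(* The real and imaginary parts of the entries form a real linear system *)
Lemma linear_ode_zero p q (D : seq R) (K t0 : R) (H : R -> 'M[CC R]_p)
    (W : R -> 'M[CC R]_(p, q)) :
  0 <= t0 <= T -> 0 <= K ->
  (forall t i j, 0 <= t <= T -> `|H t i j| <= K%:C) ->
  {within `[0, T], continuous W} ->
  (forall t, 0 < t < T -> t \notin D -> has_deriv T W t (H t *m W t)) ->
  W t0 = 0 -> forall t, 0 <= t <= T -> W t = 0.
Proof.
move=> t0T K0 HK /cont_onP cW dW W0 t tT.
pose w (k : 'I_p * 'I_q * bool) s :=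
  if k.2 then complex.Re (W s k.1.1 k.1.2) else complex.Im (W s k.1.1 k.1.2).
suff w0 k : w k t = 0.
  apply/matrixP => i j; rewrite mxE (complexE (W t i j)).
  have := w0 (i, j, false); have := w0 (i, j, true); rewrite /w/= => -> ->.
  by rewrite mulr0 addr0.
(* An entry of H W has [p] terms, each at most K times |Re| + |Im| of an entry of W, and both parts
   are bounded by the full sum of the |w_k|; hence the constant 2pK. *)
apply: (@linear_system_zero R _ D w T (2 * p%:R * K) t0) => //.
- by rewrite !mulr_ge0.
- move=> [[i j] b]; apply/subspace_continuousP => s; rewrite /= in_itv/= => sT.
  have /cvg_mxP/(_ i j)/cvg_CCP[] := cW s sT.
  by rewrite /w; case: b.
- move=> {}t {}tT tD [[i j] b].
  have tT' : 0 <= t <= T by case/andP: tT => *; rewrite !ltW.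
  exists (if b then complex.Re ((H t *m W t) i j) else complex.Im ((H t *m W t) i j)).
    have /has_derivP/(_ i j)[hr hi] := dW t tT tD.
    (* Around an interior point, [0, T] is a neighbourhood, so the limit restricted to [0, T] is an
       ordinary two-sided derivative. *)
    have inT : t^' --> within `[0, T] t^'.
      move=> P /= PT; near=> s.
      suff : `[0, T]%classic s by near: s; exact: PT.
      near: s; apply: nbhs_dnbhs; near=> s.
      have : s \in `]0, T[ by near: s; apply: near_in_itvoo; rewrite in_itv.
      by rewrite /= !in_itv/= => /andP[? ?]; rewrite !ltW.
    apply/is_derive_quotient; rewrite /w/=; case: b => /=.
      exact: cvg_trans (cvg_fmap2 inT) hr.
    exact: cvg_trans (cvg_fmap2 inT) hi.
  set S := \sum_k _.
  have wS l : `|w l t| <= S.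
    by rewrite /S (bigD1 l)//= lerDl sumr_ge0.
  have HW : `|(H t *m W t) i j| <= (2 * p%:R * K * S)%:C.
    rewrite mxE; apply: le_trans (ler_norm_sum _ _ _) _.
    apply: (@le_trans _ _ (\sum_(l < p) (K * (S + S))%:C)).
      apply: ler_sum => l _; rewrite normrM rmorphM/=.
      apply: ler_pM => //; first exact: HK.
      apply: le_trans (normCC_le _) _; rewrite lecR lerD//.
        exact: (wS (l, j, true)).
      exact: (wS (l, j, false)).
    rewrite sumr_const card_ord -rmorphMn lecR/= -mulr_natl; lra.
  by case: b; rewrite -lecR; apply: le_trans HW; [exact: normCC_Re|exact: normCC_Im].
- by move=> [[i j] b]; rewrite /w W0 mxE; case: b.
Unshelve. all: by end_near. Qed.

End matrix_calculus.

(** * Integrals of piecewise continuous functions *)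

Section primitive.
Variables (R : realType) (T : R) (D : seq R) (M : R) (f : R -> R).
Hypothesis fcont : forall t, 0 <= t <= T -> t \notin D ->
  f s @[s --> within `[0, T] (nbhs t)] --> f t.
Hypothesis fbound : forall t, 0 <= t <= T -> `|f t| <= M.
Local Notation mu := (@lebesgue_measure R).

(** On the finite set [D] every subset is measurable; off [D] the function is continuous for the
    subspace topology. *)
Lemma pc_measurable : measurable_fun `[0, T] f.
Proof.
have cD : countable [set` D] by apply: finite_set_countable; exact: finite_seq.
have mD : measurable [set` D].
  by apply: countable_measurable cD => t; exact: measurable_set1.
rewrite -(setUIDK `[0, T]%classic [set` D]); apply/measurable_funU => //.
- exact: measurableI.
- exact: measurableD.
split.
  move=> _ Y _; apply: countable_measurable => [t|]; first exact: measurable_set1.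
  by apply: sub_countable cD; apply: subset_card_le => t [[]].
apply: measurable_realfun.subspace_continuous_measurable_fun; first exact: measurableD.
apply/subspace_continuousP => t [/=]; rewrite in_itv/= => tT /negP tD.
apply: cvg_trans (fcont tT tD); apply: cvg_fmap2 => P; rewrite /within/=.
by apply: filterS => s sP [sT _]; exact: sP.
Qed.

Lemma pc_integrable (a b : itv_bound R) : (BLeft 0 <= a)%O -> (b <= BRight T)%O ->
  mu.-integrable [set` Interval a b] (EFin \o f).
Proof.
move=> a0 bT.
have ab : [set` Interval a b] `<=` `[0, T] by exact: subset_itv.
apply: (@integrableS _ _ _ mu `[0, T]) => //.
apply: measurable_bounded_integrable => //.
- rewrite /= lebesgue_measure_itv; case: ifP => // _; exact: ltry.
- exact: pc_measurable.
exists M; split; first exact: num_real.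
move=> N MN u; rewrite /= in_itv/= => /fbound/le_trans; apply; exact: ltW.
Qed.

Local Notation P := (fun t => (\int[mu]_(u in `[0, t]) f u)%R).

(** Integrate c - e <= f <= c + e over ]s, t]. The estimate serves twice: with c = 0 and e = M it
    gives continuity of the primitive, with c = f(t) its derivative. *)
Lemma primitive_increment_le s t c e : 0 <= s <= t -> t <= T ->
  (forall u, s <= u <= t -> `|f u - c| <= e) ->
  `|P t - P s - c * (t - s)| <= e * (t - s).
Proof.
move=> /andP[s0 st] tT fc.
rewrite Rintegral_itvB ?bnd_simp//; last by apply: pc_integrable; rewrite bnd_simp.
have mst : fine (mu `]s, t]) = t - s.
  rewrite lebesgue_measure_itv/= lte_fin.
  by case: ltgtP st => // -> _; rewrite subrr.
have cst k : (\int[mu]_(u in `]s, t]) k)%R = k * (t - s).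
  by rewrite Rintegral_cst// mst.
have ic k : mu.-integrable `]s, t] (EFin \o (fun=> k)).
  apply: measurable_bounded_integrable => //.
    by rewrite /= lebesgue_measure_itv; case: ifP => // _; exact: ltry.
  exists `|k|; split; first exact: num_real.
  by move=> N MN u _; exact: ltW.
have iF : mu.-integrable `]s, t] (EFin \o f).
  by apply: pc_integrable; rewrite bnd_simp.
have fcu u : `]s, t]%classic u -> c - e <= f u <= c + e.
  rewrite /= in_itv/= => /andP[su ut].
  by rewrite -ler_distl fc// (ltW su).
have h1 : (\int[mu]_(u in `]s, t]) (c - e) <= \int[mu]_(u in `]s, t]) f u)%R.
  by apply: le_Rintegral => // u /fcu/andP[].
have h2 : (\int[mu]_(u in `]s, t]) f u <= \int[mu]_(u in `]s, t]) (c + e))%R.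
  by apply: le_Rintegral => // u /fcu/andP[].
rewrite !cst in h1 h2.
by rewrite ler_distl -mulrBl -mulrDl h1 h2.
Qed.

Lemma primitive_increment s t c e : 0 <= s <= T -> 0 <= t <= T ->
  (forall u, Num.min s t <= u <= Num.max s t -> `|f u - c| <= e) ->
  `|P s - P t - c * (s - t)| <= e * `|s - t|.
Proof.
move=> /andP[s0 sT] /andP[t0 tT].
have [st|ts] := leP s t => fc.
  have := @primitive_increment_le s t c e; rewrite s0 st => /(_ isT tT fc).
  rewrite (distrC s t) (@ger0_norm _ (t - s)) ?subr_ge0//; apply: le_trans.
  by rewrite le_eqVlt -normrN; apply/orP; left; apply/eqP; congr (`| _ |); ring.
have := @primitive_increment_le t s c e; rewrite t0 (ltW ts) => /(_ isT sT fc).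
by rewrite (@ger0_norm _ (s - t)) ?subr_ge0// ltW.
Qed.

Lemma min_max_in_itv s t u : 0 <= s <= T -> 0 <= t <= T ->
  Num.min s t <= u <= Num.max s t -> 0 <= u <= T.
Proof.
move=> /andP[s0 sT] /andP[t0 tT] /andP[us ut]; apply/andP; split.
  by apply: le_trans us; rewrite le_min s0.
by apply: (le_trans ut); rewrite ge_max sT.
Qed.

Lemma primitive_continuous t : 0 <= t <= T ->
  P s @[s --> within `[0, T] (nbhs t)] --> P t.
Proof.
move=> tT; have M0 : 0 <= M by apply: le_trans (fbound tT).
apply/cvgrPdist_le => e e0; have M1 : 0 < M + 1 by rewrite ltr_wpDl.
near=> s.
have sT : 0 <= s <= T.
  have : `[0, T]%classic s by near: s; exact: withinT.
  by rewrite /= in_itv.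
have := @primitive_increment s t 0 M sT tT.
rewrite mul0r subr0 distrC => h; apply: le_trans (h _) _.
  by move=> u /(min_max_in_itv sT tT) uT; rewrite subr0; exact: fbound.
apply: (@le_trans _ _ ((M + 1) * `|s - t|)).
  by apply: ler_wpM2r => //; rewrite lerDl.
rewrite mulrC -ler_pdivlMr// distrC; near: s.
have : \forall s \near nbhs t, `|t - s| <= e / (M + 1).
  by apply: cvgr_dist_le; [exact: cvg_id|rewrite divr_gt0].
exact: cvg_within.
Unshelve. all: by end_near. Qed.

Lemma primitive_derive t : 0 <= t <= T ->
  f s @[s --> within `[0, T] (nbhs t)] --> f t ->
  (s - t)^-1 * (P s - P t) @[s --> within `[0, T] t^'] --> f t.
Proof.
move=> tT /cvgrPdist_le ft; apply/cvgrPdist_le => e e0.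
have /nbhs_ballP[r /= r0 fr] := ft e e0.
near=> s.
have [sT st] : 0 <= s <= T /\ s != t by near: s; exact: near_within_dnbhs.
have tr : `|t - s| < r.
  near: s; have tr : \forall s \near nbhs t, `|t - s| < r.
    by apply: cvgr_dist_lt => //; exact: cvg_id.
  exact: (cvg_within _ (nbhs_dnbhs tr)).
(* Every u between s and t is at least as close to t as s is, hence within the radius [r] where f is
   [e]-close to f(t). *)
have h u : Num.min s t <= u <= Num.max s t -> `|f u - f t| <= e.
  move=> ut; rewrite distrC; apply: fr.
    apply: le_lt_trans tr; move: ut.
    case: (leP s t) => [st'|st'] /andP[? ?] /=.
      by rewrite !ger0_norm ?subr_ge0//; lra.
    by rewrite !ler0_norm ?subr_le0 ?(ltW st')//; lra.
  by rewrite /= in_itv/=; exact: min_max_in_itv ut.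
have := @primitive_increment s t (f t) e sT tT h.
have st0 : s - t != 0 by rewrite subr_eq0.
rewrite -ler_pdivrMr ?normr_gt0// -normfV -normrM mulrBl.
by rewrite mulfK// distrC mulrC.
Unshelve. all: by end_near. Qed.

End primitive.

(** * Piecewise continuity and uniform bounds *)

Section piecewise_continuous.
Variables (R : realType) (T : R).

(** What integration and Gronwall's inequality use of piecewise continuity. In this form it passes
    directly to sums, products, blocks and primitives. *)
Definition pc_bounded p q (X : R -> 'M[CC R]_(p, q)) : Prop :=
  (exists D : seq R, forall t, 0 <= t <= T -> t \notin D -> cont_at T X t) /\
  (exists K : R, forall t i j, 0 <= t <= T -> `|X t i j| <= K%:C).

Lemma cvg_near_bounded (S : Type) (F : set_system S) {FF : Filter F} p q
    (X : S -> 'M[CC R]_(p, q)) (L : 'M[CC R]_(p, q)) :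
  X @ F --> L -> exists K : R, \forall s \near F, forall i j, `|X s i j| <= K%:C.
Proof.
move=> /cvg_mxP XL.
pose l (ij : 'I_p * 'I_q) := `|complex.Re (L ij.1 ij.2)| + `|complex.Im (L ij.1 ij.2)|.
exists (1 + \sum_ij l ij).
have : \forall s \near F, forall ij : 'I_p * 'I_q,
    `|L ij.1 ij.2 - X s ij.1 ij.2| < 1.
  apply: filter_forall => -[i j].
  by have /cvgrPdist_lt/(_ 1 ltr01) := XL i j.
apply: filterS => s sF i j.
rewrite -(subrK (L i j) (X s i j)).
apply: le_trans (ler_normD _ _) _; rewrite rmorphD/= lerD//.
  by rewrite distrC ltW//; exact: (sF (i, j)).
apply: le_trans (normCC_le _) _; rewrite lecR.
by rewrite (bigD1 (i, j))//= lerDl sumr_ge0// => k _; rewrite addr_ge0.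
Qed.

(** Compactness of [0, T]: near each point every sufficiently large [K] is a bound, so some [K] is a
    bound on the whole segment. *)
Lemma locally_bounded p q (X : R -> 'M[CC R]_(p, q)) :
  (forall t, 0 <= t <= T -> exists K : R, \forall s \near nbhs t,
     0 <= s <= T -> forall i j, `|X s i j| <= K%:C) ->
  exists K : R, forall t i j, 0 <= t <= T -> `|X t i j| <= K%:C.
Proof.
move=> loc.
have /compact_near_coveringP cT := @segment_compact R 0 T.
pose Q (K s : R) := 0 <= s <= T -> forall i j, `|X s i j| <= K%:C.
have : \forall K \near +oo%R, `[0, T]%classic `<=` Q K.
  apply: cT => t /=; rewrite in_itv/= => tT; have [K0 KP] := loc t tT.
  exists ([set s | Q K0 s], [set K | K0 <= K]).
    by split; [exact: KP|apply: nbhs_pinfty_ge; exact: num_real].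
  move=> [s K] [/= sQ K0K] sT i j; apply: le_trans (sQ sT i j) _.
  by rewrite lecR.
move=> /filter_ex[K KT]; exists K => t i j tT.
by apply: (KT t) => //=; rewrite in_itv.
Qed.

(** Three bounds cover a neighbourhood of t: one from each one-sided limit and one from the value at
    t. At an endpoint the missing side lies outside [0, T], where any bound will do. *)
Lemma pw_continuous_bounded p q (X : R -> 'M[CC R]_(p, q)) :
  pw_continuous T X -> pc_bounded X.
Proof.
move=> [XD Xr Xl]; split => //; apply: locally_bounded => t /andP[t0 tT].
have [Kr rP] : exists K : R, \forall s \near t^'+, s <= T ->
    forall i j, `|X s i j| <= K%:C.
  move: tT; rewrite le_eqVlt => /predU1P[<-|tT].
    exists 0; near=> s; have : t < s by near: s; exact: nbhs_right_gt.
    by rewrite ltNge => /negP.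
  have [|L /cvg_near_bounded[K KP]] := Xr t; first by rewrite t0.
  by exists K; apply: filterS KP => s sK _.
have [Kl lP] : exists K : R, \forall s \near t^'-, 0 <= s ->
    forall i j, `|X s i j| <= K%:C.
  move: t0; rewrite le_eqVlt => /predU1P[t0|t0].
    exists 0; near=> s; have : s < t by near: s; exact: nbhs_left_lt.
    by rewrite -t0 ltNge => /negP.
  have [|L /cvg_near_bounded[K KP]] := Xl t; first by rewrite t0.
  by exists K; apply: filterS KP => s sK _.
have [Kt tP] : exists K : R, forall i j, `|X t i j| <= K%:C.
  have [K KP] := @cvg_near_bounded R (nbhs t) _ _ _ (fun=> X t) (X t) (cvg_cst _).
  by exists K; exact: (nbhs_singleton KP).
exists (Num.max Kt (Num.max Kr Kl)); near=> s.
have nl : s < t -> 0 <= s -> forall i j, `|X s i j| <= Kl%:C by near: s; exact: lP.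
have nr : t < s -> s <= T -> forall i j, `|X s i j| <= Kr%:C by near: s; exact: rP.
move=> /andP[s0 sT] i j.
have up K : `|X s i j| <= K%:C -> K <= Num.max Kt (Num.max Kr Kl) ->
    `|X s i j| <= (Num.max Kt (Num.max Kr Kl))%:C.
  by move=> /le_trans sK Kmax; apply: sK; rewrite lecR.
have [st|ts|->] := ltgtP s t.
- by apply: (up _ (nl st s0 i j)); rewrite !le_max lexx !orbT.
- by apply: (up _ (nr ts sT i j)); rewrite !le_max lexx !orbT.
- by apply: (le_trans (tP i j)); rewrite lecR le_max lexx.
Unshelve. all: by end_near. Qed.

Lemma continuous_pc_bounded p q (X : R -> 'M[CC R]_(p, q)) :
  {within `[0, T], continuous X} -> pc_bounded X.
Proof.
move=> /cont_onP cX; split; first by exists [::] => t /cX.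
apply: locally_bounded => t /cX/cvg_near_bounded[K KP]; exists K.
have : nbhs t [set s | `[0, T]%classic s -> forall i j, `|X s i j| <= K%:C].
  exact: KP.
by apply: filterS => s sK sT; apply: sK; rewrite /= in_itv.
Qed.

Lemma eq_pc_bounded p q (X Y : R -> 'M[CC R]_(p, q)) :
  (forall t, 0 <= t <= T -> X t = Y t) -> pc_bounded X -> pc_bounded Y.
Proof.
move=> XY [[D XD] [K XK]]; split.
  by exists D => t tT tD; apply: eq_cont_at XY _ => //; exact: XD.
by exists K => t i j tT; rewrite -XY//; exact: XK.
Qed.

Lemma pc_boundedM p q r (X : R -> 'M[CC R]_(p, q)) (Y : R -> 'M[CC R]_(q, r)) :
  pc_bounded X -> pc_bounded Y -> pc_bounded (fun t => X t *m Y t).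
Proof.
move=> [[D XD] [K XK]] [[E YE] [L YL]]; split.
  exists (D ++ E) => t tT; rewrite mem_cat negb_or => /andP[tD tE].
  by apply: cont_atM; [exact: XD|exact: YE].
exists ((K * L) *+ q) => t i j tT; rewrite mxE.
apply: le_trans (ler_norm_sum _ _ _) _.
apply: (@le_trans _ _ (\sum_(k < q) (K * L)%:C)).
  apply: ler_sum => k _; rewrite normrM rmorphM/=.
  by apply: ler_pM => //; [exact: XK|exact: YL].
by rewrite sumr_const card_ord rmorphMn.
Qed.

Lemma pc_boundedD p q (X Y : R -> 'M[CC R]_(p, q)) :
  pc_bounded X -> pc_bounded Y -> pc_bounded (fun t => X t + Y t).
Proof.
move=> [[D XD] [K XK]] [[E YE] [L YL]]; split.
  exists (D ++ E) => t tT; rewrite mem_cat negb_or => /andP[tD tE].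
  have := @cvgD (CC R) _ _ (within `[0, T] (nbhs t)) _ X Y _ _ (XD t tT tD) (YE t tT tE).
  exact.
exists (K + L) => t i j tT; rewrite mxE.
apply: le_trans (ler_normD _ _) _; rewrite rmorphD/=.
by apply: lerD; [exact: XK|exact: YL].
Qed.

Lemma pc_bounded_cst p q (M : 'M[CC R]_(p, q)) : pc_bounded (fun=> M).
Proof.
by apply: continuous_pc_bounded; apply/cont_onP => t tT; exact: cvg_cst.
Qed.

Lemma pc_bounded_row_mx p q1 q2 (X : R -> 'M[CC R]_(p, q1))
    (Y : R -> 'M[CC R]_(p, q2)) :
  pc_bounded X -> pc_bounded Y -> pc_bounded (fun t => row_mx (X t) (Y t)).
Proof.
move=> [[D XD] [K XK]] [[E YE] [L YL]]; split.
  exists (D ++ E) => t tT; rewrite mem_cat negb_or => /andP[tD tE].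
  by apply: cvg_row_mx; [exact: XD|exact: YE].
exists (Num.max K L) => t i j tT; rewrite mxE.
case: fintype.split => k.
  by apply: (le_trans (XK t i k tT)); rewrite lecR le_max lexx.
by apply: (le_trans (YL t i k tT)); rewrite lecR le_max lexx orbT.
Qed.

Lemma pc_bounded_col_mx p1 p2 q (X : R -> 'M[CC R]_(p1, q))
    (Y : R -> 'M[CC R]_(p2, q)) :
  pc_bounded X -> pc_bounded Y -> pc_bounded (fun t => col_mx (X t) (Y t)).
Proof.
move=> [[D XD] [K XK]] [[E YE] [L YL]]; split.
  exists (D ++ E) => t tT; rewrite mem_cat negb_or => /andP[tD tE].
  by apply: cvg_col_mx; [exact: XD|exact: YE].
exists (Num.max K L) => t i j tT; rewrite mxE.
case: fintype.split => k.
  by apply: (le_trans (XK t k j tT)); rewrite lecR le_max lexx.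
by apply: (le_trans (YL t k j tT)); rewrite lecR le_max lexx orbT.
Qed.

End piecewise_continuous.

(** * Entrywise integrals of matrix-valued functions *)

Section matrix_integral.
Variables (R : realType) (T : R).

Lemma pc_bounded_entry p q (X : R -> 'M[CC R]_(p, q)) i j : pc_bounded T X ->
  exists D : seq R, exists K : R,
  [/\ forall t, 0 <= t <= T -> t \notin D -> cont_at T X t,
      forall t, 0 <= t <= T -> `|complex.Re (X t i j)| <= K
    & forall t, 0 <= t <= T -> `|complex.Im (X t i j)| <= K].
Proof.
move=> [[D XD] [K XK]]; exists D, K; split => // t tT; rewrite -lecR.
  exact: le_trans (normCC_Re _) (XK t i j tT).
exact: le_trans (normCC_Im _) (XK t i j tT).
Qed.

Lemma cont_at_entry p q (X : R -> 'M[CC R]_(p, q)) t i j : cont_at T X t ->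
  complex.Re (X s i j) @[s --> within `[0, T] (nbhs t)] --> complex.Re (X t i j) /\
  complex.Im (X s i j) @[s --> within `[0, T] (nbhs t)] --> complex.Im (X t i j).
Proof. by move=> /cvg_mxP/(_ i j)/cvg_CCP. Qed.

Lemma eq_mint p q (X Y : R -> 'M[CC R]_(p, q)) t : t <= T ->
  (forall s, 0 <= s <= T -> X s = Y s) -> mint X t = mint Y t.
Proof.
move=> tT XY; apply/matrixP => i j; rewrite !mxE.
have h s : `[0, t]%classic s -> X s = Y s.
  by rewrite /= in_itv/= => /andP[s0 st]; apply: XY; rewrite s0 (le_trans st).
by congr (_ +i* _); apply: eq_Rintegral => s /set_mem/h ->.
Qed.

Lemma mint0 p q (X : R -> 'M[CC R]_(p, q)) : mint X 0 = 0.
Proof. by apply/matrixP => i j; rewrite !mxE set_itv1 !Rintegral_set1. Qed.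

Lemma cont_at_mint p q (X : R -> 'M[CC R]_(p, q)) t :
  pc_bounded T X -> 0 <= t <= T -> cont_at T (mint X) t.
Proof.
move=> bX tT; apply/cvg_mxP => i j; apply/cvg_CCP.
have [D [K [XD XR XI]]] := pc_bounded_entry i j bX.
rewrite mxE/=; split; under eq_cvg do rewrite mxE/=.
  apply: (primitive_continuous (D := D) (f := fun s => complex.Re (X s i j)) _ XR tT).
  by move=> s sT sD; exact: (cont_at_entry i j (XD s sT sD)).1.
apply: (primitive_continuous (D := D) (f := fun s => complex.Im (X s i j)) _ XI tT).
by move=> s sT sD; exact: (cont_at_entry i j (XD s sT sD)).2.
Qed.

Lemma has_deriv_mint p q (X : R -> 'M[CC R]_(p, q)) t :
  pc_bounded T X -> 0 <= t <= T -> cont_at T X t -> has_deriv T (mint X) t (X t).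
Proof.
move=> bX tT Xt; apply/has_derivP => i j.
have [D [K [XD XR XI]]] := pc_bounded_entry i j bX.
have [Rt It] := cont_at_entry i j Xt.
rewrite mxE/=; split; under eq_cvg do rewrite mxE/=.
  apply: (primitive_derive (D := D) (f := fun s => complex.Re (X s i j)) _ XR tT Rt).
  by move=> s sT sD; exact: (cont_at_entry i j (XD s sT sD)).1.
apply: (primitive_derive (D := D) (f := fun s => complex.Im (X s i j)) _ XI tT It).
by move=> s sT sD; exact: (cont_at_entry i j (XD s sT sD)).2.
Qed.

Lemma pc_bounded_mint p q (X : R -> 'M[CC R]_(p, q)) :
  pc_bounded T X -> pc_bounded T (mint X).
Proof.
by move=> bX; apply: continuous_pc_bounded; apply/cont_onP => t; exact: cont_at_mint.
Qed.

Lemma cont_atB p q (X Y : R -> 'M[CC R]_(p, q)) t :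
  cont_at T X t -> cont_at T Y t -> cont_at T (fun s => X s - Y s) t.
Proof.
rewrite /cont_at => Xt Yt.
have := @cvg_subr_mx (CC R) R (within `[0, T] (nbhs t)) _ p q X Y _ _ Xt Yt.
apply.
Qed.

(* Both sides vanish at 0 and have the same derivative off a finite set *)
Lemma mint_mulmxl p q r (P : 'M[CC R]_(p, q)) (X : R -> 'M[CC R]_(q, r)) t :
  pc_bounded T X -> 0 <= t <= T -> mint (fun s => P *m X s) t = P *m mint X t.
Proof.
move=> bX tT; apply/eqP; rewrite -subr_eq0; apply/eqP.
have [[D XD] _] := bX.
have bPX : pc_bounded T (fun s => P *m X s).
  by apply: pc_boundedM => //; exact: pc_bounded_cst.
have T0 : 0 <= T by case/andP: tT => /le_trans; apply.
apply: (@linear_ode_zero R T p r D 0 0 (fun=> 0)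
  (fun s => mint (fun s => P *m X s) s - P *m mint X s)) => //.
- by rewrite lexx T0.
- by move=> s i j _; rewrite mxE normr0.
- apply/cont_onP => s sT; apply: cont_atB; first exact: cont_at_mint.
  by apply: cont_atM; [exact: cvg_cst|exact: cont_at_mint].
- move=> s /andP[s0 sT] sD; have sT' : 0 <= s <= T by rewrite !ltW.
  have Xs := XD s sT' sD.
  have dPX : has_deriv T (mint (fun s => P *m X s)) s (P *m X s).
    by apply: has_deriv_mint => //; apply: cont_atM => //; exact: cvg_cst.
  have := has_derivB dPX (has_derivM (has_deriv_cst T P s) (has_deriv_mint bX sT' Xs)).
  by rewrite !mul0mx add0r subrr.
- by rewrite !mint0 mulmx0 subrr.
Qed.

End matrix_integral.

(** * Uniqueness and invertibility of solutions *)

Section initial_value_problem.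
Variables (R : realType) (T : R) (n : nat).
Hypothesis T0 : 0 < T.

Lemma solves_ivp_unique (G U V : R -> 'M[CC R]_n) : pc_bounded T G ->
  solves_ivp T G U -> solves_ivp T G V -> forall t, 0 <= t <= T -> V t = U t.
Proof.
move=> [[D GD] [K GK]] [cU U0 dU] [cV V0 dV] t tT.
apply/eqP; rewrite -subr_eq0; apply/eqP.
(* The bound in [pc_bounded] has no sign, being vacuous for empty matrices; hence the absolute
   value. *)
apply: (@linear_ode_zero R T n n D `|K| 0 G (fun s => V s - U s)).
- by rewrite lexx ltW.
- exact: normr_ge0.
- by move=> s i j sT; apply: (le_trans (GK s i j sT)); rewrite lecR ler_norm.
- apply/cont_onP => s sT; move/cont_onP : cU => cU; move/cont_onP : cV => cV.
  by apply: cont_atB; [exact: cV|exact: cU].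
- move=> s /andP[s0 sT] sD; have sT' : 0 <= s <= T by rewrite !ltW.
  have := has_derivB (dV s sT' (GD s sT' sD)) (dU s sT' (GD s sT' sD)).
  by rewrite -mulmxBr.
- by rewrite U0 V0 subrr.
- exact: tT.
Qed.

(* If [U t] annihilates v, then U v is a solution vanishing at t, hence at 0. *)
Lemma solves_ivp_unit (G U : R -> 'M[CC R]_n) : pc_bounded T G ->
  solves_ivp T G U -> forall t, 0 <= t <= T -> U t \in unitmx.
Proof.
move=> [[D GD] [K GK]] [cU U0 dU] t tT.
(* [det0P] yields a row vector. It is applied to the transpose because G multiplies U on the left,
   so the kernel vector must stand on the right. *)
rewrite unitmxE unitfE -det_tr; apply/negP => /det0P[v v0 vU].
have Uv : U t *m v^T = 0 by rewrite -[U t]trmxK -trmx_mul vU trmx0.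
suff : U 0 *m v^T = 0.
  by rewrite U0 mul1mx => /(congr1 trmx); rewrite trmxK trmx0 => /eqP; apply/negP.
apply: (@linear_ode_zero R T n 1 D `|K| t G (fun s => U s *m v^T)).
- exact: tT.
- exact: normr_ge0.
- by move=> s i j sT; apply: (le_trans (GK s i j sT)); rewrite lecR ler_norm.
- apply/cont_onP => s sT; apply: cont_atM; last exact: cvg_cst.
  by move/cont_onP : cU; exact.
- move=> s /andP[s0 sT] sD; have sT' : 0 <= s <= T by rewrite !ltW.
  have := has_derivM (dU s sT' (GD s sT' sD)) (has_deriv_cst T v^T s).
  by rewrite mulmx0 addr0 mulmxA.
- exact: Uv.
- by rewrite lexx ltW.
Qed.

End initial_value_problem.

(** * The complex exponential along the real line *)

Section complex_exponential.
Variable R : realType.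
Implicit Types (c z : CC R) (t : R).

Lemma cexp0 : cexp (0 : CC R) = 1.
Proof. by rewrite /cexp/= expR0 cos0 sin0 mul1r. Qed.

Lemma cexpD z w : cexp (z + w) = cexp z * cexp w :> CC R.
Proof.
case: z w => [a b] [a' b']; rewrite /cexp/= expRD cosD sinD.
apply/eqP; rewrite eq_complex/=; apply/andP; split; apply/eqP; ring.
Qed.

Lemma cexp_line c t : cexp (c * t%:C) =
  (expR (complex.Re c * t) * cos (complex.Im c * t)) +i*
  (expR (complex.Re c * t) * sin (complex.Im c * t)).
Proof.
case: c => a b; have -> : (a +i* b) * t%:C = (a * t) +i* (b * t) :> CC R.
  by apply/eqP; rewrite eq_complex/=; apply/andP; split; apply/eqP; ring.
apply/eqP; rewrite eq_complex/=; apply/andP; split; apply/eqP; ring.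
Qed.

(** The derivative is grouped as the real part of c e^(ct) with c = a + ib; the sine version gives
    the imaginary part. *)
Lemma is_derive_expR_cos (a b t : R) :
  is_derive t 1 (fun s : R => expR (a * s) * cos (b * s))
    (a * (expR (a * t) * cos (b * t)) - b * (expR (a * t) * sin (b * t))).
Proof.
apply: is_derive_eq.
by rewrite /GRing.scale/=; ring.
Qed.

Lemma is_derive_expR_sin (a b t : R) :
  is_derive t 1 (fun s : R => expR (a * s) * sin (b * s))
    (a * (expR (a * t) * sin (b * t)) + b * (expR (a * t) * cos (b * t))).
Proof.
apply: is_derive_eq.
by rewrite /GRing.scale/=; ring.
Qed.

(** The exponential is taken as a scalar matrix so that the matrix product rule covers
    multiplication by it. *)
Lemma has_deriv_cexp (T : R) n c t :
  has_deriv T (fun s => (cexp (c * s%:C))%:M : 'M[CC R]_n) t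
    (c *: (cexp (c * t%:C))%:M).
Proof.
apply/has_derivP => i j; rewrite !mxE.
case: (i =P j) => ij.
  have /is_derive_quotient cq := is_derive_expR_cos (complex.Re c) (complex.Im c) t.
  have /is_derive_quotient sq := is_derive_expR_sin (complex.Re c) (complex.Im c) t.
  split; under eq_cvg do rewrite !mxE ij eqxx !mulr1n !cexp_line/=.
    by rewrite cexp_line mulr1n; case: c cq {sq} => a b cq; exact: cvg_within_filter.
  by rewrite cexp_line mulr1n; case: c sq {cq} => a b sq; exact: cvg_within_filter.
rewrite mulr0n mulr0; move/eqP/negbTE : ij => ij.
by split; under eq_cvg do rewrite !mxE ij mulr0n subrr mulr0; exact: cvg_cst.
Qed.

Lemma cont_at_cexp (T : R) n c t :
  cont_at T (fun s => (cexp (c * s%:C))%:M : 'M[CC R]_n) t.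
Proof.
have dc (f : R -> R) l : is_derive t 1 f l ->
    f s @[s --> within `[0, T] (nbhs t)] --> f t.
  move=> fl; apply: cvg_within_filter; apply: differentiable_continuous.
  by apply/derivable1_diffP; exact: ex_derive.
apply/cvg_mxP => i j; rewrite mxE; under eq_cvg do rewrite mxE.
case: (i == j); rewrite ?mulr1n ?mulr0n /=.
  apply/cvg_CCP; split; under eq_cvg do rewrite cexp_line/=.
    by rewrite cexp_line/=; exact: dc (is_derive_expR_cos _ _ _).
  by rewrite cexp_line/=; exact: dc (is_derive_expR_sin _ _ _).
exact: (@cvg_cst (CC R) 0).
Qed.

Lemma cont_at_exp_scale (T : R) n c (X : R -> 'M[CC R]_n) t :
  cont_at T X t -> cont_at T (exp_scale c X) t.
Proof.
move=> Xt; have := cont_atM (@cont_at_cexp T n c t) Xt.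
rewrite /cont_at mul_scalar_mx.
by under eq_cvg do rewrite mul_scalar_mx.
Qed.

Lemma pc_bounded_exp_scale (T : R) n c (X : R -> 'M[CC R]_n) :
  pc_bounded T X -> pc_bounded T (exp_scale c X).
Proof.
move=> bX; apply: (@eq_pc_bounded _ _ _ _ (fun t => (cexp (c * t%:C))%:M *m X t)).
  by move=> t _; rewrite mul_scalar_mx.
apply: pc_boundedM => //; apply: continuous_pc_bounded.
by apply/cont_onP => t _; exact: cont_at_cexp.
Qed.

Lemma has_deriv_exp_scale (T : R) n c (X : R -> 'M[CC R]_n) t L :
  has_deriv T X t L ->
  has_deriv T (exp_scale c X) t (c *: exp_scale c X t + cexp (c * t%:C) *: L).
Proof.
move=> XL; have := has_derivM (@has_deriv_cexp T n c t) XL.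
rewrite -scalemxAl !mul_scalar_mx /exp_scale.
rewrite (_ : (fun s => _ *m _) = fun s => cexp (c * s%:C) *: X s)//.
by apply/funext => s; rewrite mul_scalar_mx.
Qed.

End complex_exponential.

(** * Iterated integrals *)

Section iterated_integrals.
Variables (R : realType) (T : R) (n : nat) (G U : R -> 'M[CC R]_n).
Hypothesis T0 : 0 < T.
Hypothesis bG : pc_bounded T G.
Hypothesis GU : solves_ivp T G U.

Let unitU t : 0 <= t <= T -> U t \in unitmx.
Proof. exact: (solves_ivp_unit T0 bG GU). Qed.

Let contU t : 0 <= t <= T -> cont_at T U t.
Proof. by have [/cont_onP cU _ _] := GU; exact: cU. Qed.

(** [A] in the interaction picture defined by [U]. *)
Let conj (A : R -> 'M[CC R]_n) s := invmx (U s) *m A s *m U s.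

Lemma cont_at_invU t : 0 <= t <= T -> cont_at T (fun s => invmx (U s)) t.
Proof.
move=> tT; apply: cvg_invmx; [exact: unitU| |exact: contU].
near=> s; apply: unitU.
have : `[0, T]%classic s by near: s; exact: withinT.
by rewrite /= in_itv.
Unshelve. all: by end_near. Qed.

Lemma cont_at_conj A t : 0 <= t <= T -> cont_at T A t -> cont_at T (conj A) t.
Proof.
move=> tT At; apply: cont_atM (contU tT); apply: cont_atM At; exact: cont_at_invU.
Qed.

Lemma pc_bounded_conj A : pc_bounded T A -> pc_bounded T (conj A).
Proof.
move=> bA; apply: pc_boundedM; first apply: pc_boundedM => //.
  by apply: continuous_pc_bounded; apply/cont_onP => t; exact: cont_at_invU.
by apply: continuous_pc_bounded; apply/cont_onP => t; exact: contU.
Qed.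

(* Out of range the default [fun=> 0] makes the condition vacuous. *)
Definition all_pc_bounded (As : seq (R -> 'M[CC R]_n)) :=
  forall i, pc_bounded T (nth (fun=> 0) As i).

(** The two claims need each other in the induction: extracting the accumulator from the inner
    integral leaves the integrand [P] times a one-variable function, and boundedness of the inner
    integral is what allows [P] to leave the outer one. *)
Lemma nested_int_mulmxl As : all_pc_bounded As ->
  pc_bounded T (nested_int U 1%:M As) /\
  forall P t, 0 <= t <= T -> nested_int U P As t = P *m nested_int U 1%:M As t.
Proof.
elim: As => [|A As IH] bAs /=.
  by split=> [|P t _]; [exact: pc_bounded_cst|rewrite mulmx1].
have [bN NE] := IH (fun i => bAs i.+1).
have bA : pc_bounded T A := bAs 0%N.
have bF : pc_bounded T (fun s => conj A s *m nested_int U 1%:M As s).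
  by apply: pc_boundedM bN; exact: pc_bounded_conj.
have E P t : 0 <= t <= T ->
    mint (fun s => nested_int U (P *m (invmx (U s) *m A s *m U s)) As s) t =
    P *m mint (fun s => conj A s *m nested_int U 1%:M As s) t.
  move=> tT; have [_ tT'] := andP tT.
  rewrite -(mint_mulmxl P bF tT); apply: (eq_mint tT') => s sT.
  by rewrite NE// /conj !mulmxA.
split=> [|P t tT].
  apply: eq_pc_bounded (pc_bounded_mint bF) => t tT.
  by rewrite E// mul1mx.
by rewrite !E// mul1mx.
Qed.

(** In the definition, s occurs both in the accumulator and as the upper limit of the inner
    integral. Here the two occurrences separate into a product, so the outermost integral is the
    primitive of a product of two known functions. *)
Lemma nested_int_cons A As t : all_pc_bounded As -> pc_bounded T A -> 0 <= t <= T ->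
  mint (fun s => conj A s *m nested_int U 1%:M As s) t =
  nested_int U 1%:M (A :: As) t.
Proof.
move=> bAs bA /andP[t0 tT]; apply: (eq_mint tT) => s sT.
rewrite /= mul1mx; apply/esym.
exact: ((nested_int_mulmxl bAs).2 (conj A s) s sT).
Qed.

Lemma pc_bounded_integrand A As : all_pc_bounded As -> pc_bounded T A ->
  pc_bounded T (fun s => conj A s *m nested_int U 1%:M As s).
Proof.
move=> bAs bA; apply: pc_boundedM; first exact: pc_bounded_conj.
exact: (nested_int_mulmxl bAs).1.
Qed.

Lemma cont_at_nested_int As t : all_pc_bounded As -> 0 <= t <= T ->
  cont_at T (nested_int U 1%:M As) t.
Proof.
case: As => [|A As] bAs tT; first exact: cvg_cst.
have bA := bAs 0%N; have {}bAs : all_pc_bounded As := fun i => bAs i.+1.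
apply: (eq_cont_at tT (fun s sT => nested_int_cons bAs bA sT)).
by apply: cont_at_mint => //; exact: pc_bounded_integrand.
Qed.

Lemma cont_at_DU As t : all_pc_bounded As -> 0 <= t <= T -> cont_at T (DU U As) t.
Proof.
by move=> bAs tT; apply: cont_atM; [exact: contU|exact: cont_at_nested_int].
Qed.

Lemma DU_nil : DU U [::] = U.
Proof. by apply/funext => t; rewrite /DU/= mulmx1. Qed.

Lemma DU_cons0 A As : DU U (A :: As) 0 = 0.
Proof. by rewrite /DU/= mint0 mulmx0. Qed.

Lemma has_deriv_DU A As t : all_pc_bounded As -> pc_bounded T A -> 0 <= t <= T ->
  cont_at T G t -> cont_at T A t ->
  has_deriv T (DU U (A :: As)) t (G t *m DU U (A :: As) t + A t *m DU U As t).
Proof.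
move=> bAs bA tT Gt At; have [_ _ dU] := GU.
have dN : has_deriv T (nested_int U 1%:M (A :: As)) t
    (conj A t *m nested_int U 1%:M As t).
  have Ft := cont_atM (cont_at_conj tT At) (cont_at_nested_int bAs tT).
  have dF := has_deriv_mint (pc_bounded_integrand bAs bA) tT Ft.
  exact: (eq_has_deriv tT (fun s sT => nested_int_cons bAs bA sT) dF).
have := has_derivM (dU t tT Gt) dN.
rewrite /DU -!mulmxA (mulKVmx (unitU tT)).
exact.
Qed.

End iterated_integrals.

(* Stated over an abstract ring: unifying the structures of [CC R] with those of
   [R[i]] in these rewrites does not terminate in practice. *)
Lemma scaled_rhs (K : comNzRingType) n (G D A E : 'M[K]_n) (c k e : K) :
  c *: (k *: D) + k *: (G *m D + (e *: A) *m E) =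
  (G + c%:M) *m (k *: D) + A *m ((k * e) *: E).
Proof.
rewrite mulmxDl mul_scalar_mx scalerDr -!scalemxAr -scalemxAl !scalerA.
by rewrite addrCA addrA.
Qed.

(** * Exponential prefactors and the shifted equations *)

Section exponential_scaling.
Variables (R : realType) (T : R) (n : nat) (G U : R -> 'M[CC R]_n).
Hypothesis T0 : 0 < T.
Hypothesis bG : pc_bounded T G.
Hypothesis GU : solves_ivp T G U.

(** One link of the coupled chain: the weight e^(et) on the head merges with the prefactor e^(ct),
    so the inner term comes with exponent c + e, the prefactor of the next function. The choice c =
    0 gives the first block row. *)
Lemma has_deriv_scaled_DU c e A As t :
  all_pc_bounded T As -> pc_bounded T A -> 0 <= t <= T ->
  cont_at T G t -> cont_at T A t ->
  has_deriv T (exp_scale c (DU U (exp_scale e A :: As))) t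
    ((G t + c%:M) *m exp_scale c (DU U (exp_scale e A :: As)) t +
     A t *m exp_scale (c + e) (DU U As) t).
Proof.
move=> bAs bA tT Gt At.
have bE := pc_bounded_exp_scale e bA; have Et := cont_at_exp_scale (c := e) At.
have := has_deriv_exp_scale (c := c) (has_deriv_DU T0 bG GU bAs bE tT Gt Et).
congr (has_deriv _ _ _ _).
have E : exp_scale (c + e) (DU U As) t =
    (cexp (c * t%:C) * cexp (e * t%:C)) *: DU U As t.
  by rewrite /exp_scale mulrDl cexpD.
rewrite E; exact: scaled_rhs.
Qed.

Lemma has_deriv_scaled_U c t : 0 <= t <= T -> cont_at T G t ->
  has_deriv T (exp_scale c U) t ((G t + c%:M) *m exp_scale c U t).
Proof.
move=> tT Gt; have [_ _ dU] := GU.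
have := has_deriv_exp_scale (c := c) (dU t tT Gt).
congr (has_deriv _ _ _ _).
have := scaled_rhs (G t) (U t) 0 0 c (cexp (c * t%:C)) 0.
by rewrite !mul0mx mulmx0 !addr0.
Qed.

Lemma continuous_scaled_DU c As : all_pc_bounded T As ->
  {within `[0, T], continuous (exp_scale c (DU U As))}.
Proof.
move=> bAs; apply/cont_onP => t tT; apply: cont_at_exp_scale.
exact: (cont_at_DU T0 bG GU).
Qed.

Lemma exp_scale_DU_cons0 c A As : exp_scale c (DU U (A :: As)) 0 = 0.
Proof. by rewrite /exp_scale DU_cons0 scaler0. Qed.

Lemma exp_scale_U0 c : exp_scale c U 0 = 1%:M.
Proof. by have [_ U0 _] := GU; rewrite /exp_scale mulr0 cexp0 scale1r. Qed.

Lemma exp_scale0 (X : R -> 'M[CC R]_n) : exp_scale 0 X = X.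
Proof. by apply/funext => t; rewrite /exp_scale mul0r cexp0 scale1r. Qed.

End exponential_scaling.

(** * Indexing of the coupled functions *)

Section coupled_system.
Variables (R : realType) (T : R) (n : nat).

(** At k = m the list is empty and [DU] of it is [U], so one formula covers both branches of
    [xfun]. *)
Lemma xfunE (U : R -> 'M[CC R]_n) A d m k : (k <= m)%N ->
  xfun U A d m k = exp_scale (dsum d k)
    (DU U [seq exp_scale (d i) (A i) | i <- index_iota k.+1 m.+1]).
Proof.
move=> km; apply/funext => t; rewrite /xfun /exp_scale.
case: ltnP => // mk; have -> : k = m by apply/eqP; rewrite eqn_leq km.
by rewrite /index_iota subnn/= DU_nil.
Qed.

Lemma index_iota_cons k m : (k < m)%N ->
  index_iota k.+1 m.+1 = k.+1 :: index_iota k.+2 m.+1.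
Proof. by move=> km; rewrite /index_iota subSS -subnSK// subSS. Qed.

Lemma dsumS (d : nat -> CC R) k : dsum d k.+1 = dsum d k + d k.+1.
Proof. by rewrite /dsum big_nat_recr. Qed.

Lemma all_pc_bounded_exp_scale (A : nat -> R -> 'M[CC R]_n) d k m :
  (forall i, (k < i <= m)%N -> pc_bounded T (A i)) ->
  all_pc_bounded T [seq exp_scale (d i) (A i) | i <- index_iota k.+1 m.+1].
Proof.
move=> bA i; have [im|im] := ltnP i (m - k).
  rewrite (nth_map 0%N) ?size_iota ?subSS// nth_iota ?subSS//.
  by apply: pc_bounded_exp_scale; apply: bA; lia.
by rewrite nth_default ?size_map ?size_iota ?subSS//; exact: pc_bounded_cst.
Qed.

End coupled_system.

(** * Block triangular generators *)

Section block_matrices.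
Variables (R : realType) (T : R) (n : nat).
Implicit Types X Y : R -> 'M[CC R]_n.

Lemma block3_mx1 : block3_mx 1%:M 0 0 0 1%:M 0 0 0 1%:M = 1%:M :> 'M[CC R]_(n + (n + n)).
Proof. by rewrite /block3_mx row_mx0 col_mx0 -!scalar_mx_block. Qed.

Lemma mul_block3_utmx (A11 A12 A13 A22 A23 A33 B11 B12 B13 B22 B23 B33 : 'M[CC R]_n) :
  block3_mx A11 A12 A13 0 A22 A23 0 0 A33 *m
  block3_mx B11 B12 B13 0 B22 B23 0 0 B33 =
  block3_mx (A11 *m B11) (A11 *m B12 + A12 *m B22)
      (A11 *m B13 + A12 *m B23 + A13 *m B33)
    0 (A22 *m B22) (A22 *m B23 + A23 *m B33) 0 0 (A33 *m B33).
Proof.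
rewrite /block3_mx !col_mx0 !mulmx_block mul_row_block mul_mx_row.
by rewrite !mulmx0 !mul0mx !addr0 !add0r add_row_mx addrA.
Qed.

Lemma cont_at_row_mx p q1 q2 (X : R -> 'M[CC R]_(p, q1))
    (Y : R -> 'M[CC R]_(p, q2)) t :
  cont_at T X t -> cont_at T Y t -> cont_at T (fun s => row_mx (X s) (Y s)) t.
Proof. by rewrite /cont_at => Xt Yt; apply: cvg_row_mx; [exact: Xt|exact: Yt]. Qed.

Lemma cont_at_col_mx p1 p2 q (X : R -> 'M[CC R]_(p1, q))
    (Y : R -> 'M[CC R]_(p2, q)) t :
  cont_at T X t -> cont_at T Y t -> cont_at T (fun s => col_mx (X s) (Y s)) t.
Proof. by rewrite /cont_at => Xt Yt; apply: cvg_col_mx; [exact: Xt|exact: Yt]. Qed.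

Lemma cont_at_mxsub p q p' q' (f : 'I_p' -> 'I_p) (g : 'I_q' -> 'I_q)
    (X : R -> 'M[CC R]_(p, q)) t :
  cont_at T X t -> cont_at T (fun s => mxsub f g (X s)) t.
Proof. by rewrite /cont_at => Xt; apply: cvg_mxsub; exact: Xt. Qed.

Section upper_triangular.
Variables X11 X12 X13 X22 X23 X33 : R -> 'M[CC R]_n.
Local Notation utmx := (fun s => block3_mx (X11 s) (X12 s) (X13 s)
  0 (X22 s) (X23 s) 0 0 (X33 s)).

Lemma has_deriv_block3_utmx t L11 L12 L13 L22 L23 L33 :
  has_deriv T X11 t L11 -> has_deriv T X12 t L12 -> has_deriv T X13 t L13 ->
  has_deriv T X22 t L22 -> has_deriv T X23 t L23 -> has_deriv T X33 t L33 ->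
  has_deriv T utmx t (block3_mx L11 L12 L13 0 L22 L23 0 0 L33).
Proof.
move=> h11 h12 h13 h22 h23 h33; have h0 := @has_deriv_cst R T n n 0 t.
exact: (has_deriv_col_mx (has_deriv_row_mx h11 (has_deriv_row_mx h12 h13))
  (has_deriv_row_mx (has_deriv_col_mx h0 h0)
    (has_deriv_col_mx (has_deriv_row_mx h22 h23) (has_deriv_row_mx h0 h33)))).
Qed.

Lemma cont_at_block3_utmx t :
  cont_at T X11 t -> cont_at T X12 t -> cont_at T X13 t ->
  cont_at T X22 t -> cont_at T X23 t -> cont_at T X33 t -> cont_at T utmx t.
Proof.
move=> h11 h12 h13 h22 h23 h33.
have h0 : cont_at T (fun=> 0 : 'M[CC R]_n) t by exact: cvg_cst.
exact: (cont_at_col_mx (cont_at_row_mx h11 (cont_at_row_mx h12 h13))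
  (cont_at_row_mx (cont_at_col_mx h0 h0)
    (cont_at_col_mx (cont_at_row_mx h22 h23) (cont_at_row_mx h0 h33)))).
Qed.

Lemma pc_bounded_block3_utmx :
  pc_bounded T X11 -> pc_bounded T X12 -> pc_bounded T X13 ->
  pc_bounded T X22 -> pc_bounded T X23 -> pc_bounded T X33 -> pc_bounded T utmx.
Proof.
move=> h11 h12 h13 h22 h23 h33; have h0 := @pc_bounded_cst R T n n 0.
exact: (pc_bounded_col_mx (pc_bounded_row_mx h11 (pc_bounded_row_mx h12 h13))
  (pc_bounded_row_mx (pc_bounded_col_mx h0 h0)
    (pc_bounded_col_mx (pc_bounded_row_mx h22 h23) (pc_bounded_row_mx h0 h33)))).
Qed.

(** The block equation is required where the block generator is continuous, while the derivatives of
    its solution need continuity of G, A_1 and A_2. The blocks (1,1), (1,2) and (2,3), read off as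
    submatrices, hold exactly these. *)
Lemma cont_at_block3_utmx_inv t : cont_at T utmx t ->
  [/\ cont_at T X11 t, cont_at T X12 t & cont_at T X23 t].
Proof.
move=> Xt; split.
- have := cont_at_mxsub (f := @lshift n (n + n)) (g := @lshift n (n + n)) Xt.
  congr (cont_at _ _ _); apply/funext => s; apply/matrixP => i j.
  by rewrite mxE block_mxEul.
- have := cont_at_mxsub (f := @lshift n (n + n))
    (g := fun j => @rshift n (n + n) (lshift n j)) Xt.
  congr (cont_at _ _ _); apply/funext => s; apply/matrixP => i j.
  by rewrite mxE block_mxEur row_mxEl.
have := cont_at_mxsub (f := fun j => @rshift n (n + n) (lshift n j))
  (g := fun j => @rshift n (n + n) (rshift n j)) Xt.
congr (cont_at _ _ _); apply/funext => s; apply/matrixP => i j.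
by rewrite mxE block_mxEdr block_mxEur.
Qed.

End upper_triangular.

End block_matrices.

(** * The coupled equations and the three-by-three block exponential *)

Theorem mainTheorem3 (R : realType) (T : R) (n m : nat)
    (G : R -> 'M[CC R]_n) (A : nat -> R -> 'M[CC R]_n) (d : nat -> CC R)
    (U : R -> 'M[CC R]_n) :
  0 < T -> (1 <= n)%N -> (1 <= m)%N ->
  pw_continuous T G ->
  (forall i : nat, (1 <= i <= m)%N -> pw_continuous T (A i)) ->
  is_Texp T G U ->
  let x := xfun U A d m in
  [/\ forall k : nat, (k < m)%N ->
        [/\ {within `[0, T], continuous (x k)},
            x k 0 = 0
          & forall t : R, 0 <= t <= T ->
              cont_at T G t -> cont_at T (A k.+1) t ->
              has_deriv T (x k) t
                ((G t + (dsum d k)%:M) *m x k t + A k.+1 t *m x k.+1 t)],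
      [/\ {within `[0, T], continuous (x m)},
          x m 0 = 1%:M
        & forall t : R, 0 <= t <= T -> cont_at T G t ->
            has_deriv T (x m) t ((G t + (dsum d m)%:M) *m x m t)]
    & m = 2%N ->
      is_Texp T
        (fun t => block3_mx
           (G t) (A 1%N t)              0
           0     (G t + (d 1%N)%:M)     (A 2%N t)
           0     0                      (G t + (d 1%N + d 2%N)%:M))
        (fun t => block3_mx
           (U t)
             (DU U [:: exp_scale (d 1%N) (A 1%N)] t)
             (DU U [:: exp_scale (d 1%N) (A 1%N);
                       exp_scale (d 2%N) (A 2%N)] t)
           0
             (cexp (d 1%N * t%:C) *: U t)
             (cexp (d 1%N * t%:C) *: DU U [:: exp_scale (d 2%N) (A 2%N)] t)
           0
             0
             (cexp ((d 1%N + d 2%N) * t%:C) *: U t))].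
Proof.
move=> T0 n1 m1 pG pA [GU _] x.
have bG := pw_continuous_bounded pG.
have bA i : (1 <= i <= m)%N -> pc_bounded T (A i).
  by move=> im; exact: pw_continuous_bounded (pA i im).
have bAs k : all_pc_bounded T [seq exp_scale (d i) (A i) | i <- index_iota k.+1 m.+1].
  by apply: all_pc_bounded_exp_scale => i ikm; apply: bA; lia.
have b0 : all_pc_bounded T ([::] : seq (R -> 'M[CC R]_n)).
  by move=> i; rewrite nth_nil; exact: pc_bounded_cst.
split.
- move=> k km; have bAk : pc_bounded T (A k.+1) by apply: bA; lia.
  (* Unfolding the list of x_k once exposes A_(k+1) at its head and leaves exactly the list of
     x_(k+1), empty when k + 1 = m. *)
  rewrite /x (xfunE _ _ _ (ltnW km)) (xfunE _ _ _ km) (index_iota_cons km) map_cons.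
  split.
  + have := continuous_scaled_DU T0 bG GU (c := dsum d k) (bAs k).
    by rewrite (index_iota_cons km) map_cons.
  + exact: exp_scale_DU_cons0.
  + move=> t tT Gt At; rewrite dsumS.
    exact: (has_deriv_scaled_DU T0 bG GU (bAs k.+1) bAk tT Gt At).
- have xm : x m = exp_scale (dsum d m) U.
    by rewrite /x (xfunE _ _ _ (leqnn m)) /index_iota subnn DU_nil.
  rewrite xm; split.
  + have := continuous_scaled_DU T0 bG GU (c := dsum d m) b0.
    by rewrite DU_nil.
  + exact: (exp_scale_U0 GU).
  + move=> t tT Gt; exact: (has_deriv_scaled_U GU).
move=> m2; have b1 : pc_bounded T (A 1%N) by apply: bA; rewrite m2.
have b2 : pc_bounded T (A 2%N) by apply: bA; rewrite m2.
have bE2 : all_pc_bounded T [:: exp_scale (d 2%N) (A 2%N)].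
  by move: (bAs 1%N); rewrite m2.
(* This list stops before A_2, so it is not the list of any x_k and is not an instance of [bAs]. *)
have bE1 : all_pc_bounded T [:: exp_scale (d 1%N) (A 1%N)].
  by case=> [|i]; [exact: pc_bounded_exp_scale|exact: b0].
have bE12 : all_pc_bounded T [:: exp_scale (d 1%N) (A 1%N); exp_scale (d 2%N) (A 2%N)].
  by move: (bAs 0%N); rewrite m2.
set H := (X in is_Texp T X _); set V := (X in is_Texp T _ X).
have bH : pc_bounded T H.
  have bD c : pc_bounded T (fun t => G t + c%:M).
    by apply: pc_boundedD => //; exact: pc_bounded_cst.
  apply: pc_bounded_block3_utmx => //; exact: pc_bounded_cst.
have VH : solves_ivp T H V.
  split.
  + apply/cont_onP => t tT; have [/cont_onP cU _ _] := GU.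
    apply: cont_at_block3_utmx.
    * exact: cU.
    * exact: (cont_at_DU T0 bG GU bE1 tT).
    * exact: (cont_at_DU T0 bG GU bE12 tT).
    * exact: cont_at_exp_scale (cU t tT).
    * exact: cont_at_exp_scale (cont_at_DU T0 bG GU bE2 tT).
    * exact: cont_at_exp_scale (cU t tT).
  + have [_ U0 _] := GU.
    by rewrite /V !DU_cons0 U0 !mulr0 cexp0 scaler0 !scale1r block3_mx1.
  + move=> t tT /cont_at_block3_utmx_inv[Gt A1t A2t].
    (* As the (1,3) block of the generator vanishes, each upper triangular block of the product has
       at most two terms and is the right-hand side of a scaled equation. *)
    rewrite mul_block3_utmx mul0mx addr0.
    apply: has_deriv_block3_utmx.
    * by have [_ _ dU] := GU; exact: dU.
    * have := has_deriv_scaled_DU T0 bG GU (c := 0) (e := d 1%N) b0 b1 tT Gt A1t.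
      by rewrite !exp_scale0 DU_nil add0r raddf0 addr0.
    * have := has_deriv_scaled_DU T0 bG GU (c := 0) (e := d 1%N) bE2 b1 tT Gt A1t.
      by rewrite !exp_scale0 add0r raddf0 addr0.
    * exact: (has_deriv_scaled_U GU).
    * have := has_deriv_scaled_DU T0 bG GU (c := d 1%N) (e := d 2%N) b0 b2 tT Gt A2t.
      by rewrite DU_nil.
    * exact: (has_deriv_scaled_U GU).
split=> // W WH t tT; exact: (solves_ivp_unique T0 bH VH WH).
Qed.
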